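(* Let $G$ be a group, $K$ a complete, non-discretely valued field and $d\geq 1$ an integer, with $d<\mathrm{char}(K)$ if $\mathrm{char}(K)>0$. Let $(\rho_n)_{n\in\mathbb{N}}$ be a sequence of representations $\rho_n\colon G\to \mathrm{GL}_d(K)$ which is trace-convergent, and let $\rho\colon G\to\mathrm{GL}_d(\overline{K})$ be its limit representation. Assume that $\rho$ is irreducible. Then the representations $\rho_n$ are absolutely irreducible for all $n$ large enough, $(\rho_n)$ is physically convergent, and $\rho$ is defined over $K$ (i.e. is conjugate to a representation with values in $\mathrm{GL}_d(K)$). If moreover $(\rho_n)$ is uniformly trace-convergent, then it is uniformly physically convergent.
   Context: $\overline{K}$ is an algebraic closure of $K$. The sequence $(\rho_n)$ is trace-convergent if for every $g\in G$ the sequence $\mathrm{tr}(\rho_n(g))$ converges in $K$; it is uniformly trace-convergent if the functions $g\mapsto \mathrm{tr}(\rho_n(g))$ converge uniformly on $G$. It is physically convergent if for each $n$ there is a $K$-basis of $K^d$ such that, writing $c^n_{i,j}(g)$ for the matrix coefficients of $\rho_n(g)$ in this basis, the sequence $(c^n_{i,j}(g))_n$ converges in $K$ for every $g\in G$ and all $i,j$; it is uniformly physically convergent if moreover the functions $c^n_{i,j}$ converge uniformly on $G$. If $(\rho_n)$ is trace-convergent, $T(g):=\lim_n \mathrm{tr}(\rho_n(g))$ is a $d$-dimensional pseudo-character, and the limit representation $\rho$ is the (unique up to isomorphism) semisimple representation $G\to\mathrm{GL}_d(\overline{K})$ with trace $T$. *)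

(* Defs.v *)
From HB Require Import structures.
From mathcomp Require Import all_boot all_order all_algebra.
From mathcomp Require Import all_classical all_reals topology.

Set Implicit Arguments.
Unset Strict Implicit.
Unset Printing Implicit Defensive.

Import Order.TTheory GRing.Theory Num.Theory.

Local Open Scope classical_set_scope.
Local Open Scope ring_scope.

(* A field with a real-valued absolute value, archimedean or not, carrying the
   induced metric.  The norm of [normedZmodType] is unsuitable here: its axiom
   [`|x *+ n| = `|x| *+ n] excludes ultrametric and positive-characteristic
   fields. *)
HB.mixin Record PseudoMetricField_isValued (R : realType) K
    & GRing.Field K & PseudoMetric R K := {
  absv : K -> R;
  absv_ge0 : forall x, 0 <= absv x;
  absv_eq0 : forall x, absv x = 0 <-> x = 0;
  absvM : forall x y, absv (x * y) = absv x * absv y;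
  ler_absvD : forall x y, absv (x + y) <= absv x + absv y;
  ball_absvE : forall (x : K) (e : R) (y : K), ball x e y <-> absv (x - y) < e
}.

#[short(type="completeValuedFieldType")]
HB.structure Definition CompleteValuedField (R : realType) :=
  { K of GRing.Field K & PseudoMetric R K & Complete K
       & PseudoMetricField_isValued R K }.

Definition nontrivially_valued (R : realType) (K : completeValuedFieldType R) :=
  exists x : K, x != 0 /\ absv x != 1.

Definition algebraic_closure (K : fieldType) (L : closedFieldType)
    (iota : {rmorphism K -> L}) :=
  forall x : L, algebraicOver iota x.

Section Representations.
Variables (G : groupType) (d : nat).

Record representation (F : fieldType) := Representation {
  repr_mx :> G -> 'M[F]_d;
  repr_mx1 : repr_mx 1%g = 1%:M;
  repr_mxM : forall x y, repr_mx (x * y)%g = repr_mx x *m repr_mx y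
}.

(* Hence a [representation] is a homomorphism to GL_d(F). *)
Lemma repr_mx_unit (F : fieldType) (rho : representation F) g :
  rho g \in unitmx.
Proof.
by have /mulmx1_unit[] : rho g *m rho g^-1%g = 1%:M
  by rewrite -repr_mxM mulgV repr_mx1.
Qed.

(* The group acts on column vectors by left multiplication. *)
Definition invariant_sub (F : fieldType) (rho : representation F)
    (U : {vspace 'cV[F]_d}) :=
  forall g v, v \in U -> rho g *m v \in U.

Definition irreducible_sub (F : fieldType) (rho : representation F)
    (U : {vspace 'cV[F]_d}) :=
  [/\ invariant_sub rho U, U <> 0%VS
    & forall V, invariant_sub rho V -> (V <= U)%VS -> V = 0%VS \/ V = U].

Definition irreducible (F : fieldType) (rho : representation F) :=
  irreducible_sub rho fullv.

Definition semisimple (F : fieldType) (rho : representation F) :=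
  exists (m : nat) (U : 'I_m -> {vspace 'cV[F]_d}),
    [/\ forall i, irreducible_sub rho (U i),
        directv (\sum_i U i)%VS & (\sum_i U i)%VS = fullv].

Lemma map_repr1 (F E : fieldType) (f : {rmorphism F -> E})
    (rho : representation F) : map_mx f (rho 1%g) = 1%:M.
Proof. by rewrite repr_mx1 map_mx1. Qed.

Lemma map_reprM (F E : fieldType) (f : {rmorphism F -> E})
    (rho : representation F) x y :
  map_mx f (rho (x * y)%g) = map_mx f (rho x) *m map_mx f (rho y).
Proof. by rewrite repr_mxM map_mxM. Qed.

Definition extend_scalars (F E : fieldType) (f : {rmorphism F -> E})
    (rho : representation F) : representation E :=
  Representation (map_repr1 f rho) (map_reprM f rho).

Definition absolutely_irreducible (F : fieldType) (rho : representation F) :=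
  forall (E : fieldType) (f : {rmorphism F -> E}),
    irreducible (extend_scalars f rho).

(* [conj_mx P A] is the matrix of [A] in the basis formed by the columns
   of [P]. *)
Definition conj_mx (F : fieldType) (P A : 'M[F]_d) : 'M[F]_d :=
  invmx P *m A *m P.

Definition defined_over (F E : fieldType) (f : {rmorphism F -> E})
    (rho : representation E) :=
  exists (rho0 : representation F) (P : 'M[E]_d),
    P \in unitmx /\ forall g, conj_mx P (rho g) = extend_scalars f rho0 g.

End Representations.

Section Convergence.
Variables (R : realType) (K : completeValuedFieldType R).
Variables (G : groupType) (d : nat).
Implicit Types (rhos : nat -> representation G d K).

Definition trace_convergent rhos :=
  forall g, cvg (\tr (rhos n g) @[n --> \oo]).

Definition uniformly_trace_convergent rhos :=
  exists T : G -> K, {uniform, (fun n g => \tr (rhos n g)) @ \oo --> T}.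

Definition physically_convergent rhos :=
  exists P : nat -> 'M[K]_d, (forall n, P n \in unitmx) /\
    forall g i j, cvg (conj_mx (P n) (rhos n g) i j @[n --> \oo]).

Definition uniformly_physically_convergent rhos :=
  exists P : nat -> 'M[K]_d, (forall n, P n \in unitmx) /\
    forall i j, exists c : G -> K,
      {uniform, (fun n g => conj_mx (P n) (rhos n g) i j) @ \oo --> c}.

Definition limit_trace rhos (g : G) : K := lim (\tr (rhos n g) @[n --> \oo]).

(* Meaningful when [rhos] is trace-convergent and [iota] is an algebraic
   closure of [K]. *)
Definition limit_representation (L : closedFieldType)
    (iota : {rmorphism K -> L}) rhos (rho : representation G d L) :=
  semisimple rho /\ forall g, \tr (rho g) = iota (limit_trace rhos g).

End Convergence.

(* Main.v *)
Require Import Defs.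
From HB Require Import structures.
From mathcomp Require Import all_boot all_order all_algebra.
From mathcomp Require Import all_classical all_reals interval_inference topology.
From mathcomp Require Import ring lra.

Set Implicit Arguments.
Unset Strict Implicit.
Unset Printing Implicit Defensive.

Import Order.TTheory GRing.Theory Num.Theory.

Local Open Scope classical_set_scope.
Local Open Scope ring_scope.

(* By Burnside's theorem some rho(g_i), i < d^2, form a basis of M_d, and their
   Gram matrix (T(g_i g_j)) is invertible.  Hence for n large the rho_n(g_i) also
   form a basis, and the coordinates of rho_n(g) in it, in particular its
   multiplication table, are rational functions of traces, so they converge; the
   limit table is that of a K-form A of M_d.  As d is invertible in K, the inverse
   Gram matrix divided by d is a separability idempotent of A, with which Newton's
   method deforms the approximately multiplicative map A -> M_d(K),
   rho(g_i) |-> rho_n(g_i), into an algebra morphism, the deformation tending to 0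
   with n.  Composing it with G -> A yields a representation tau_n over K with
   trace T.  The tau_n are conjugate to each other by Skolem-Noether, and the
   matrices conjugating them to a fixed one make rho_n converge.

   All limits are uniform if T is bounded.  If T is unbounded and tr rho_n - T is
   bounded, then every linear relation between the rho_n(g) also holds between the
   tau(g), tau being a K-form of rho: otherwise the two-sided ideal generated by
   its defect is everything and T is bounded.  So rho_n is conjugate to tau. *)

(** * Linear combinations and coordinates *)

Section LinearCombinations.
Variables (F : fieldType) (n : nat).

Definition lincomb (V : lmodType F) (X : 'I_n -> V) (x : 'rV[F]_n) : V :=
  \sum_k x 0 k *: X k.

Definition bilincomb (V : lmodType F) (W : 'M[F]_n) (Z : 'I_n -> 'I_n -> V) : V :=
  \sum_i \sum_j W i j *: Z i j.

Section Lmodule.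
Variable V : lmodType F.
Implicit Types (X Y : 'I_n -> V) (Z : 'I_n -> 'I_n -> V) (x : 'rV[F]_n)
  (W : 'M[F]_n).

Lemma lincomb_is_linear X : linear (lincomb X).
Proof.
move=> a x y; rewrite /lincomb scaler_sumr -big_split; apply: eq_bigr => k _ /=.
by rewrite !mxE scalerDl scalerA.
Qed.

HB.instance Definition _ X :=
  GRing.isLinear.Build F 'rV[F]_n V *:%R (lincomb X) (lincomb_is_linear X).

Lemma lincomb_delta X k : lincomb X (delta_mx 0 k) = X k.
Proof.
rewrite /lincomb (bigD1 k) //= mxE !eqxx scale1r big1 ?addr0 // => j njk.
by rewrite mxE eqxx (negPf njk) scale0r.
Qed.

Lemma eq_lincomb X Y x : X =1 Y -> lincomb X x = lincomb Y x.
Proof. by move=> XY; apply: eq_bigr => k _; rewrite XY. Qed.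

Lemma lincombD X Y x : lincomb (fun k => X k + Y k) x = lincomb X x + lincomb Y x.
Proof. by rewrite -big_split; apply: eq_bigr => k _; rewrite scalerDr. Qed.

Lemma lincombN X x : lincomb (fun k => - X k) x = - lincomb X x.
Proof. by rewrite -sumrN; apply: eq_bigr => k _; rewrite scalerN. Qed.

Lemma lincombB X Y x : lincomb (fun k => X k - Y k) x = lincomb X x - lincomb Y x.
Proof. by rewrite lincombD lincombN. Qed.

Lemma eq_bilincomb W Z Z' : (forall i j, Z i j = Z' i j) ->
  bilincomb W Z = bilincomb W Z'.
Proof. by move=> ZZ'; apply: eq_bigr => i _; apply: eq_bigr => j _; rewrite ZZ'. Qed.

Lemma bilincombE W Z : bilincomb W Z = \sum_i lincomb (Z i) (row i W).
Proof. by apply: eq_bigr => i _; apply: eq_bigr => j _; rewrite mxE. Qed.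

Lemma bilincombD W Z Z' :
  bilincomb W (fun i j => Z i j + Z' i j) = bilincomb W Z + bilincomb W Z'.
Proof.
by rewrite !bilincombE -big_split; apply: eq_bigr => i _; apply: lincombD.
Qed.

Lemma bilincombN W Z : bilincomb W (fun i j => - Z i j) = - bilincomb W Z.
Proof. by rewrite !bilincombE -sumrN; apply: eq_bigr => i _; apply: lincombN. Qed.

Lemma bilincombB W Z Z' :
  bilincomb W (fun i j => Z i j - Z' i j) = bilincomb W Z - bilincomb W Z'.
Proof. by rewrite bilincombD bilincombN. Qed.

End Lmodule.

Lemma linear_lincomb (V V' : lmodType F) (f : {linear V -> V'}) X x :
  f (lincomb X x) = lincomb (fun k => f (X k)) x.
Proof. by rewrite linear_sum; apply: eq_bigr => k _; rewrite linearZ. Qed.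

Lemma linear_bilincomb (V V' : lmodType F) (f : {linear V -> V'}) W Z :
  f (bilincomb W Z) = bilincomb W (fun i j => f (Z i j)).
Proof.
by rewrite !bilincombE linear_sum; apply: eq_bigr => i _; rewrite linear_lincomb.
Qed.

Lemma lincomb_bilincomb (V : lmodType F) W (Z : 'I_n -> 'I_n -> 'I_n -> V) x :
  lincomb (fun k => bilincomb W (Z k)) x
  = bilincomb W (fun i j => lincomb (fun k => Z k i j) x).
Proof.
rewrite /lincomb /bilincomb; under eq_bigr do rewrite scaler_sumr.
rewrite exchange_big; apply: eq_bigr => i _.
under eq_bigr do rewrite scaler_sumr.
rewrite exchange_big; apply: eq_bigr => j _; rewrite scaler_sumr.
by apply: eq_bigr => k _; rewrite !scalerA mulrC.
Qed.

Lemma lincomb_mull d (A : 'M[F]_d) (X : 'I_n -> 'M[F]_d) x :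
  A *m lincomb X x = lincomb (fun k => A *m X k) x.
Proof. exact: (linear_lincomb (mulmx A)). Qed.

Lemma lincomb_mulr d (A : 'M[F]_d) (X : 'I_n -> 'M[F]_d) x :
  lincomb X x *m A = lincomb (fun k => X k *m A) x.
Proof. exact: (linear_lincomb (mulmxr A)). Qed.

Lemma bilincomb_mull d (A : 'M[F]_d) W (Z : 'I_n -> 'I_n -> 'M[F]_d) :
  A *m bilincomb W Z = bilincomb W (fun i j => A *m Z i j).
Proof. exact: (linear_bilincomb (mulmx A)). Qed.

Lemma bilincomb_mulr d (A : 'M[F]_d) W (Z : 'I_n -> 'I_n -> 'M[F]_d) :
  bilincomb W Z *m A = bilincomb W (fun i j => Z i j *m A).
Proof. exact: (linear_bilincomb (mulmxr A)). Qed.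

Lemma mxtrace_lincomb d (X : 'I_n -> 'M[F]_d) x :
  \tr (lincomb X x) = \sum_k x 0 k * \tr (X k).
Proof. by rewrite raddf_sum; apply: eq_bigr => k _; rewrite /= mxtraceZ. Qed.

Section Bases.
Variable V : vectType F.
Implicit Types X : 'I_n -> V.

Definition is_basis X := basis_of fullv [tuple X k | k < n].

Definition coords X v : 'rV[F]_n := \row_k coord [tuple X k | k < n] k v.

Lemma coords_is_linear X : linear (coords X).
Proof. by move=> a u v; apply/rowP => k; rewrite !mxE linearP. Qed.

HB.instance Definition _ X :=
  GRing.isLinear.Build F V 'rV[F]_n *:%R (coords X) (coords_is_linear X).

Let lincomb_tuple X (x : 'I_n -> F) :
  \sum_k x k *: [tuple X k | k < n]`_k = lincomb X (\row_k x k).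
Proof. by apply: eq_bigr => k _; rewrite nth_mktuple mxE. Qed.

Lemma coordsK X : is_basis X -> cancel (coords X) (lincomb X).
Proof. by move=> bX v; rewrite -lincomb_tuple -(coord_basis bX) ?memvf. Qed.

Lemma lincombK X : is_basis X -> cancel (lincomb X) (coords X).
Proof.
move=> /basis_free fX x; apply/rowP => k.
have -> : x = \row_j x 0 j by apply/rowP => j; rewrite mxE.
by rewrite -lincomb_tuple [LHS]mxE coord_sum_free // [RHS]mxE.
Qed.

Lemma coords_basis X k : is_basis X -> coords X (X k) = delta_mx 0 k.
Proof. by move=> bX; rewrite -[X k]lincomb_delta lincombK. Qed.

Lemma is_basis_of_ker0 X : (\dim {:V} <= n)%N ->
  (forall x, lincomb X x = 0 -> x = 0) -> is_basis X.
Proof.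
move=> dimV X_inj; rewrite /is_basis basisEfree subvf size_tuple dimV !andbT.
apply/freeP => x; rewrite lincomb_tuple => /X_inj/rowP x0 k.
by have := x0 k; rewrite !mxE.
Qed.

End Bases.
End LinearCombinations.

Lemma map_lincomb (F E : fieldType) (f : {rmorphism F -> E}) n d e
    (X : 'I_n -> 'M[F]_(d, e)) x :
  map_mx f (lincomb X x) = lincomb (fun k => map_mx f (X k)) (map_mx f x).
Proof.
by rewrite raddf_sum; apply: eq_bigr => k _; rewrite /= map_mxZ mxE.
Qed.

Lemma map_bilincomb (F E : fieldType) (f : {rmorphism F -> E}) n d e W
    (Z : 'I_n -> 'I_n -> 'M[F]_(d, e)) :
  map_mx f (bilincomb W Z)
  = bilincomb (map_mx f W) (fun i j => map_mx f (Z i j)).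
Proof.
rewrite !bilincombE raddf_sum; apply: eq_bigr => i _.
by rewrite /= map_lincomb map_row.
Qed.

(** * Algebra endomorphisms and the trace form of a matrix algebra *)

Section MatrixAlgebra.
Variables (F : fieldType) (d : nat).
Implicit Types (A B P : 'M[F]_d) (X Y : 'I_(d * d) -> 'M[F]_d).

Lemma mul_delta_mx_col m n (i : 'I_m) (k : 'I_n) (v : 'cV[F]_n) :
  delta_mx i k *m v = v k 0 *: delta_mx i 0.
Proof.
rewrite -(mul_delta_mx (0 : 'I_1)) -mulmxA -rowE [row k v]mx11_scalar mxE.
exact: mul_mx_scalar.
Qed.

Lemma mul_mx_delta A (k l : 'I_d) : A *m delta_mx k l = \sum_i A i k *: delta_mx i l.
Proof.
rewrite {1}[A]matrix_sum_delta mulmx_suml; apply: eq_bigr => i _.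
rewrite mulmx_suml (bigD1 k) //= -scalemxAl mul_delta_mx big1 ?addr0 // => j nj.
by rewrite -scalemxAl mul_delta_mx_0 // scaler0.
Qed.

Lemma delta_mx_sandwich A (a b k l : 'I_d) :
  delta_mx a k *m A *m delta_mx l b = A k l *: delta_mx a b.
Proof.
rewrite -mulmxA mul_mx_delta mulmx_sumr (bigD1 k) //=.
rewrite -scalemxAr mul_delta_mx big1 ?addr0 // => i nik.
by rewrite -scalemxAr mul_delta_mx_0 ?scaler0 // eq_sym.
Qed.

Lemma exists_entry_neq0 m n (A : 'M[F]_(m, n)) : A != 0 -> exists i j, A i j != 0.
Proof.
move=> A0; apply: contrapT => A_eq0; move/eqP: A0; apply.
apply/matrixP => i j; rewrite mxE; apply/eqP/negPn/negP => Aij.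
by apply: A_eq0; exists i, j.
Qed.

Lemma intertwiner_unitmx (phi : 'M[F]_d -> 'M[F]_d) P :
  (forall A, phi A *m P = P *m A) -> P != 0 -> P \in unitmx.
Proof.
move=> phiP P0; rewrite -unitmx_tr -row_free_unit; apply: inj_row_free => v.
move=> /(congr1 trmx); rewrite trmx_mul trmxK trmx0 => Pv0.
apply/eqP; apply: contraNT P0 => /exists_entry_neq0[i [k vk0]].
apply/eqP/matrixP => a b.
have : P *m (delta_mx b k *m v^T) = 0 by rewrite mulmxA -phiP -mulmxA Pv0 mulmx0.
rewrite mul_delta_mx_col mxE -scalemxAr -colE => /eqP.
rewrite ord1 in vk0; rewrite scaler_eq0 (negPf vk0) /= => /eqP/colP/(_ a).
by rewrite !mxE.
Qed.

(* For a fixed vector [v] such that [phi (delta_mx k k) *m v != 0], the columns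
   of the intertwiner are the vectors [phi (delta_mx a k) *m v]. *)
Lemma skolem_noether (phi : {linear 'M[F]_d -> 'M[F]_d}) :
  phi 1%:M = 1%:M -> {morph phi : A B / A *m B} ->
  exists2 P, P \in unitmx & forall A, conj_mx P (phi A) = A.
Proof.
move=> phi1 phiM; have [k _|d0] := pickP 'I_d; last first.
  exists 1%:M; rewrite ?unitmx1 // => A; apply/matrixP => i.
  by have := d0 i.
have [i [j phi_ij]] : exists i j, phi (delta_mx k k) i j != 0.
  apply: exists_entry_neq0; apply/eqP => phik0.
  have /matrixP/(_ k k)/eqP : (1%:M : 'M[F]_d) = 0.
    rewrite -phi1 mx1_sum_delta linear_sum big1 // => a _.
    have -> : delta_mx a a = delta_mx a k *m delta_mx k k *m delta_mx k a :> 'M[F]_d.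
      by rewrite !mul_delta_mx.
    by rewrite !phiM phik0 mulmx0 mul0mx.
  by rewrite !mxE eqxx oner_eq0.
pose P := \matrix_(b, a) phi (delta_mx a k) b j.
have phiP A : phi A *m P = P *m A.
  apply/matrixP => b a; transitivity (phi (A *m delta_mx a k) b j).
    by rewrite phiM !mxE; apply: eq_bigr => m _; rewrite mxE.
  rewrite mul_mx_delta linear_sum summxE mxE; apply: eq_bigr => m _.
  by rewrite linearZ !mxE mulrC.
have uP : P \in unitmx.
  apply: intertwiner_unitmx phiP _; apply: contraNneq phi_ij => /matrixP/(_ i k).
  by rewrite !mxE => ->.
by exists P => // A; rewrite /conj_mx -mulmxA phiP mulKmx.
Qed.

Definition gram X : 'M[F]_(d * d) := \matrix_(i, j) \tr (X i *m X j).

Definition trace_row n (X : 'I_n -> 'M[F]_d) A : 'rV[F]_n := \row_j \tr (A *m X j).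

Definition mul_table X i j : 'rV[F]_(d * d) := coords X (X i *m X j).

Lemma mxtrace_mul_delta A (i j : 'I_d) : \tr (A *m delta_mx j i) = A i j.
Proof.
rewrite -(mul_delta_mx (0 : 'I_1)) mulmxA mxtrace_mulC -colE -rowE.
by rewrite /mxtrace big_ord1 !mxE.
Qed.

Lemma trace_form_nondegenerate A : (forall B, \tr (A *m B) = 0) -> A = 0.
Proof. by move=> A0; apply/matrixP => i j; rewrite mxE -mxtrace_mul_delta. Qed.

Lemma trace_row_is_linear n (X : 'I_n -> 'M[F]_d) : linear (trace_row X).
Proof.
by move=> a A B; apply/rowP => j; rewrite !mxE mulmxDl -scalemxAl linearP.
Qed.

HB.instance Definition _ n (X : 'I_n -> 'M[F]_d) :=
  GRing.isLinear.Build F 'M[F]_d 'rV[F]_n *:%R (trace_row X)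
    (trace_row_is_linear X).

Lemma gram_sym X : (gram X)^T = gram X.
Proof. by apply/matrixP => i j; rewrite !mxE mxtrace_mulC. Qed.

Lemma trace_row_lincomb X x : trace_row X (lincomb X x) = x *m gram X.
Proof.
apply/rowP => j; rewrite !mxE lincomb_mulr mxtrace_lincomb.
by apply: eq_bigr => i _; rewrite mxE.
Qed.

Lemma trace_orthogonal_full (U : {vspace 'M[F]_d}) :
  (forall A, (forall B, B \in U -> \tr (A *m B) = 0) -> A = 0) -> U = fullv.
Proof.
move=> U_orth; pose f := linfun (trace_row (fun j : 'I_(\dim U) => (vbasis U)`_j)).
have f_inj : (fullv :&: lker f)%VS = 0%VS.
  apply/eqP; rewrite capfv -subv0; apply/subvP => A.
  rewrite memv_ker lfunE memv0 => /eqP/rowP A0; apply/eqP/U_orth => B.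
  move=> /coord_vbasis ->.
  rewrite mulmx_sumr raddf_sum big1 // => j _; rewrite /= -scalemxAr mxtraceZ.
  by have := A0 j; rewrite !mxE => ->; rewrite mulr0.
apply/eqP; rewrite eqEdim subvf -(limg_dim_eq f_inj) /=.
by apply: leq_trans (dimvS (subvf _)) _; rewrite dimvf /dim /= mul1n.
Qed.

Lemma is_basis_gram X : is_basis X = (gram X \in unitmx).
Proof.
apply/idP/idP => [bX|uX].
  rewrite -row_free_unit; apply: inj_row_free => x; rewrite -trace_row_lincomb => x0.
  apply: (can_inj (lincombK bX)); rewrite linear0.
  apply: trace_form_nondegenerate => B; rewrite -(coordsK bX B) lincomb_mull.
  rewrite mxtrace_lincomb big1 // => j _; have /rowP/(_ j) := x0.
  by rewrite !mxE => ->; rewrite mulr0.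
apply: is_basis_of_ker0 => [|x x0]; first by rewrite dimvf.
by rewrite -(mulmxK uX x) -trace_row_lincomb x0 linear0 mul0mx.
Qed.

Lemma coords_gram X A : is_basis X ->
  coords X A = trace_row X A *m invmx (gram X).
Proof.
move=> bX; rewrite -{2}(coordsK bX A) trace_row_lincomb mulmxK //.
by rewrite -is_basis_gram.
Qed.

Lemma gram_dual_expansion X A : is_basis X ->
  A = bilincomb (invmx (gram X)) (fun i j => \tr (A *m X i) *: X j).
Proof.
move=> bX; rewrite -{1}(coordsK bX A) coords_gram // mulmx_sum_row linear_sum.
rewrite bilincombE; apply: eq_bigr => i _; rewrite linearZ /= mxE.
by rewrite -[RHS]linear_lincomb.
Qed.

Lemma mulmx_basis X i j : is_basis X -> X i *m X j = lincomb X (mul_table X i j).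
Proof. by move=> bX; rewrite coordsK. Qed.

(* The tensor [\sum_(i, j) invmx (gram X) i j *: X i \otimes X j] does not depend
   on the basis: it equals [\sum_(k, l) delta_mx k l \otimes delta_mx l k]. *)
Lemma casimir_sandwich X A : is_basis X ->
  bilincomb (invmx (gram X)) (fun i j => X i *m A *m X j) = (\tr A)%:M.
Proof.
move=> bX; apply/matrixP => a b.
have entry W (Z : 'I_(d * d) -> 'I_(d * d) -> 'M[F]_d) k l :
    bilincomb W Z k l = \sum_i \sum_j W i j * Z i j k l.
  rewrite summxE; apply: eq_bigr => i _; rewrite summxE.
  by apply: eq_bigr => j _; rewrite mxE.
transitivity (\sum_k (A *m delta_mx k a) k b); last first.
  rewrite mxE -sumrMnl; apply: eq_bigr => k _.
  rewrite -(mul_delta_mx (0 : 'I_1)) mulmxA -colE mxE big_ord1 !mxE eqxx /=.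
  by rewrite eq_sym mulr_natr.
under [RHS]eq_bigr => k _ do
  rewrite [delta_mx k a](gram_dual_expansion _ bX) bilincomb_mull entry.
rewrite entry [RHS]exchange_big; apply: eq_bigr => i _ /=.
rewrite [RHS]exchange_big; apply: eq_bigr => j _ /=.
rewrite -mulr_sumr -mulmxA; congr (_ * _); rewrite mxE; apply: eq_bigr => k _.
by rewrite mxtrace_mulC mxtrace_mul_delta -scalemxAr [in RHS]mxE.
Qed.

End MatrixAlgebra.

Section SeparableTables.
Variables (F : fieldType) (n : nat).
Implicit Types (c : 'I_n -> 'I_n -> 'rV[F]_n) (W : 'M[F]_n).

Definition mulc c (x y : 'rV[F]_n) : 'rV[F]_n :=
  lincomb (fun i => lincomb (c i) y) x.

Definition has_mul_table d (X : 'I_n -> 'M[F]_d) c :=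
  forall i j, X i *m X j = lincomb X (c i j).

Lemma lincombM d (X : 'I_n -> 'M[F]_d) c x y : has_mul_table X c ->
  lincomb X (mulc c x y) = lincomb X x *m lincomb X y.
Proof.
move=> XM; rewrite linear_lincomb lincomb_mulr; apply: eq_lincomb => i /=.
by rewrite linear_lincomb lincomb_mull; apply: eq_lincomb => j; rewrite /= XM.
Qed.

(* [c] is the multiplication table of a unital associative algebra, in a basis
   [e] with unit [e i0], and [\sum_(i, j) W i j *: e i \otimes e j] is a
   separability idempotent of that algebra. *)
Record separable_table c W (i0 : 'I_n) : Prop := SeparableTable {
  table_assoc : forall i j k, lincomb (c^~ k) (c i j) = lincomb (c i) (c j k);
  table_unit : forall j, c j i0 = delta_mx 0 j;
  sep_mul : bilincomb W c = delta_mx 0 i0;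
  sep_central : forall i k l,
    \sum_j W j l * c i j 0 k = \sum_j W k j * c j i 0 l
}.

Lemma bilincomb_central (V : lmodType F) c W i0 a (Z : 'I_n -> 'I_n -> V) :
  separable_table c W i0 ->
  bilincomb W (fun i j => lincomb (Z i) (c j a))
  = bilincomb W (fun i j => lincomb (Z^~ j) (c a i)).
Proof.
move=> sepW; transitivity (\sum_k \sum_l (\sum_j W k j * c j a 0 l) *: Z k l).
  apply: eq_bigr => k _; under [RHS]eq_bigr do rewrite scaler_suml.
  rewrite exchange_big; apply: eq_bigr => j _; rewrite scaler_sumr.
  by apply: eq_bigr => l _; rewrite scalerA.
under eq_bigr => k _ do
  under eq_bigr => l _ do rewrite -(sep_central sepW) scaler_suml.
rewrite exchange_big [RHS]exchange_big; apply: eq_bigr => l _ /=.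
rewrite exchange_big; apply: eq_bigr => j _; rewrite scaler_sumr.
by apply: eq_bigr => k _; rewrite scalerA.
Qed.

End SeparableTables.

Lemma basis_separable_table (F : fieldType) d (X : 'I_(d * d) -> 'M[F]_d) i0 :
  is_basis X -> X i0 = 1%:M -> d%:R != 0 :> F ->
  separable_table (mul_table X) (d%:R^-1 *: invmx (gram X)) i0.
Proof.
move=> bX X1 d0; split=> [i j k|j||i k l].
- rewrite -[LHS](linear_lincomb (coords X \o mulmxr (X k))) /=.
  rewrite -[RHS](linear_lincomb (coords X \o mulmx (X i))) /=.
  by rewrite -!mulmx_basis // mulmxA.
- by rewrite /mul_table X1 mulmx1 coords_basis.
- rewrite -[LHS](linear_bilincomb (coords X)) -(coords_basis i0 bX) X1.
  congr (coords X _); rewrite bilincombE.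
  under eq_bigr do rewrite linearZ linearZ /=.
  rewrite -scaler_sumr -bilincombE.
  have -> : bilincomb (invmx (gram X)) (fun i j => X i *m X j) = d%:R%:M.
    rewrite -mxtrace1 -(casimir_sandwich _ bX); apply: eq_bilincomb => i j.
    by rewrite mulmx1.
  by rewrite scale_scalar_mx mulVf.
pose I := invmx (gram X).
have I_sym p q : I p q = I q p by rewrite {1}/I -(gram_sym X) -trmx_inv mxE.
pose t : 'M[F]_(d * d) := \matrix_(j, m) \tr (X i *m X j *m X m).
transitivity (d%:R^-1 * (I *m t *m I) l k).
  rewrite -mulmxA mxE mulr_sumr; apply: eq_bigr => j _; rewrite mxE mulrA -/I I_sym.
  congr (_ * _); rewrite /mul_table coords_gram // !mxE.
  by apply: eq_bigr => m _; rewrite !mxE.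
rewrite mxE mulr_sumr; apply: eq_bigr => j _; rewrite [in RHS]mxE -/I -mulrA.
congr (_ * _); rewrite mulrC I_sym; congr (_ * _).
rewrite /mul_table coords_gram // !mxE; apply: eq_bigr => m _.
rewrite !mxE -/I I_sym mulrC; congr (_ * _).
by rewrite mxtrace_mulC mulmxA.
Qed.

(** * Burnside's theorem *)

Lemma closed_field_eigenvalue (L : closedFieldType) n (A : 'M[L]_n) :
  (0 < n)%N -> exists a, eigenvalue A a.
Proof.
case: n A => // n A _; have /closed_rootP[a root_a] : size (char_poly A) != 1.
  by rewrite size_char_poly.
by exists a; rewrite eigenvalue_root_char.
Qed.

Section MatrixSpaces.
Variables (F : fieldType) (d : nat).
Implicit Types (U : {vspace 'M[F]_d}) (A B : 'M[F]_d).

Definition mul_closed U := forall A B, A \in U -> B \in U -> A *m B \in U.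

Definition vector_transitive U :=
  forall v w : 'cV[F]_d, v != 0 -> exists2 A, A \in U & A *m v = w.

Lemma span_mul_closed (S : seq 'M[F]_d) :
  (forall A B, A \in S -> B \in S -> A *m B \in <<S>>%VS) -> mul_closed <<S>>.
Proof.
move=> SM A B SA.
pose lmul C : 'End('M[F]_d) := linfun (mulmx C).
pose rmul C : 'End('M[F]_d) := linfun (mulmxr C).
have lmulE C D : lmul C D = C *m D by rewrite lfunE.
have rmulE C D : rmul C D = D *m C by rewrite lfunE.
have SMl C D : C \in S -> D \in <<S>>%VS -> C *m D \in <<S>>%VS.
  move=> SC; rewrite -lmulE memv_preim; apply/subvP/span_subvP => E SE.
  by rewrite -memv_preim lmulE SM.
move=> SB; rewrite -rmulE memv_preim; apply: subvP SA; apply/span_subvP => C SC.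
by rewrite -memv_preim rmulE SMl.
Qed.

End MatrixSpaces.

Section Burnside.
Variables (L : closedFieldType) (d : nat) (U : {vspace 'M[L]_d}).
Hypotheses (UM : mul_closed U) (Utrans : vector_transitive U).

(* Write [T = C *m B] with [C] and [B] of full rank, and choose [A] such that
   [M = B *m A *m C] is not scalar.  For an eigenvalue [a] of [M], the element
   [T *m A *m T - a *: T = C *m (M - a%:M) *m B] has the required properties. *)
Lemma rank_reduction T : T \in U -> (1 < \rank T)%N ->
  exists T', [/\ T' \in U, T' != 0 & (\rank T' < \rank T)%N].
Proof.
move=> UT rT; set r := \rank T in rT.
have [C [B [C' [B' [TE C'C BB']]]]] : exists (C : 'M_(d, r)) (B : 'M_(r, d)) C' B',
    [/\ T = C *m B, C' *m C = 1%:M & B *m B' = 1%:M].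
  have [C' C'C] := row_fullP (col_base_full T).
  have [B' BB'] := row_freeP (row_base_free T).
  by exists (col_base T), (row_base T), C', B'; rewrite mulmx_base.
pose i : 'I_r := Ordinal (ltnW rT); pose j : 'I_r := Ordinal rT.
have Ci0 : C *m delta_mx i (0 : 'I_1) != 0.
  apply/eqP => /(congr1 (mulmx C')); rewrite mulmxA C'C mul1mx mulmx0.
  by move/matrixP/(_ i 0)/eqP; rewrite !mxE !eqxx oner_eq0.
have [A UA ACi] := Utrans (B' *m delta_mx j 0) Ci0.
pose M := B *m A *m C; have [a eigen_a] := closed_field_eigenvalue M (ltnW rT).
pose T' := T *m A *m T - a *: T.
have T'E : T' = C *m (M - a%:M) *m B.
  by rewrite mulmxBr mulmxBl mul_mx_scalar -scalemxAl /M !mulmxA -TE -mulmxA -TE.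
exists T'; split; first by rewrite memvB ?memvZ // !UM.
  apply/eqP => T'0; have : C' *m T' *m B' = 0 by rewrite T'0 mulmx0 mul0mx.
  rewrite T'E -!mulmxA BB' mulmx1 mulmxA C'C mul1mx => /eqP.
  rewrite subr_eq0 => /eqP/(congr1 (mulmx^~ (delta_mx i (0 : 'I_1)))) /=.
  rewrite /M -!mulmxA ACi mulmxA BB' mul1mx => /matrixP/(_ j 0)/eqP.
  by rewrite mul_scalar_mx !mxE !eqxx mulr0 oner_eq0.
rewrite T'E (leq_ltn_trans (mxrankM_maxl _ _)) //.
rewrite (leq_ltn_trans (mxrankM_maxr _ _)) // ltn_neqAle rank_leq_row andbT.
by apply: contraL eigen_a => fM; rewrite negbK kermx_eq0.
Qed.

Lemma exists_rank1 T : T \in U -> T != 0 -> exists2 T', T' \in U & \rank T' = 1%N.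
Proof.
have [r] := ubnP (\rank T); elim: r T => // r IHr T rT UT T0.
have [rT_le1|rT_gt1] := leqP (\rank T) 1.
  by exists T => //; apply/eqP; rewrite eqn_leq rT_le1 lt0n mxrank_eq0.
have [T' [UT' T'0 rT']] := rank_reduction UT rT_gt1.
by apply: (IHr T') => //; apply: leq_trans rT' _.
Qed.

(* If [Z] is orthogonal to [U] and [C *m B \in U] has rank one, then
   [B *m A2 *m Z *m A1 *m C = 0] for all [A1] and [A2] in [U]. *)
Theorem burnside : U = fullv.
Proof.
apply: trace_orthogonal_full => Z Z_orth; apply/eqP/negPn/negP => Z0.
have [i [j Zij]] := exists_entry_neq0 Z0.
have [T UT T0] : exists2 T, T \in U & T != 0.
  have ei0 : delta_mx i 0 != 0 :> 'cV[L]_d.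
    by apply/eqP => /matrixP/(_ i 0)/eqP; rewrite !mxE !eqxx oner_eq0.
  have [T UT Tei] := Utrans (delta_mx i 0) ei0; exists T => //.
  by apply: contraNneq ei0 => T0; rewrite -Tei T0 mul0mx.
have {T UT T0} [T UT rT] := exists_rank1 UT T0.
have [C [B TE]] : exists (C : 'cV[L]_d) (B : 'rV[L]_d), T = C *m B.
  have := mulmx_base T; move: (col_base T) (row_base T).
  by rewrite rT => C B; exists C, B.
have T0 : T != 0 by rewrite -mxrank_eq0 rT.
have C0 : C != 0 by apply: contraNneq T0 => C0; rewrite TE C0 mul0mx.
have [a [k Bk]] : exists a k, B a k != 0.
  by apply: exists_entry_neq0; apply: contraNneq T0 => B0; rewrite TE B0 mulmx0.
have [A1 UA1 A1C] := Utrans (delta_mx j 0) C0.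
have ZA1C0 : Z *m (A1 *m C) != 0.
  by rewrite A1C -colE; apply: contraNneq Zij => /matrixP/(_ i 0); rewrite !mxE => ->.
have [A2 UA2 A2w] := Utrans (delta_mx k 0) ZA1C0.
have := Z_orth _ (UM (UM UA1 UT) UA2).
have -> : Z *m (A1 *m T *m A2) = Z *m (A1 *m C) *m (B *m A2) by rewrite TE !mulmxA.
rewrite mxtrace_mulC -mulmxA A2w -colE => /eqP; apply/negP.
by rewrite /mxtrace big_ord1 mxE; rewrite (ord1 a) in Bk.
Qed.

End Burnside.

(** * Bases of matrix algebras from representations *)

Lemma is_basis_map (F E : fieldType) (f : {rmorphism F -> E}) d
    (X : 'I_(d * d) -> 'M[F]_d) : is_basis (map_mx f \o X) = is_basis X.
Proof.
rewrite !is_basis_gram -(map_unitmx f); congr (_ \in unitmx).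
by apply/matrixP => i j; rewrite !mxE -map_mxM trace_map_mx.
Qed.

Section ConjugateMatrices.
Variables (F : fieldType) (d : nat).
Implicit Types A P : 'M[F]_d.

Lemma conj_mx_lincomb n P (X : 'I_n -> 'M[F]_d) x :
  conj_mx P (lincomb X x) = lincomb (fun k => conj_mx P (X k)) x.
Proof. by rewrite /conj_mx lincomb_mull lincomb_mulr. Qed.

Lemma mxtrace_conj_mx P A : P \in unitmx -> \tr (conj_mx P A) = \tr A.
Proof. by move=> uP; rewrite /conj_mx mxtrace_mulC mulKVmx. Qed.

Lemma conj_mxK P : P \in unitmx -> cancel (conj_mx P) (conj_mx (invmx P)).
Proof.
by move=> uP A; rewrite /conj_mx invmxK !mulmxA mulmxV // mul1mx mulmxK.
Qed.

End ConjugateMatrices.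

Section IrreducibleRepresentations.
Variables (G : groupType) (d : nat).

Section Field.
Variables (F : fieldType) (rho : representation G d F).

Lemma irreducible_dim_gt0 : irreducible rho -> (0 < d)%N.
Proof.
move=> [_ full0 _]; rewrite lt0n; apply/eqP => d0; apply: full0.
by apply/eqP; rewrite -dimv_eq0 dimvf /dim /= d0.
Qed.

Lemma irreducible_vector_transitive (U : {vspace 'M[F]_d}) :
  irreducible rho -> 1%:M \in U ->
  (forall g A, A \in U -> rho g *m A \in U) -> vector_transitive U.
Proof.
move=> [_ _ irr] U1 UM v w v0; pose ev : {linear 'M[F]_d -> 'cV[F]_d} := mulmxr v.
have evE A : linfun ev A = A *m v by rewrite lfunE.
have inv : invariant_sub rho (linfun ev @: U)%VS.
  move=> g _ /memv_imgP[A UA ->]; apply/memv_imgP.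
  by exists (rho g *m A); rewrite ?UM // !evE mulmxA.
have v_in : v \in (linfun ev @: U)%VS.
  by apply/memv_imgP; exists 1%:M; rewrite // evE mul1mx.
case: (irr _ inv (subvf _)) => imU; first by rewrite imU memv0 (negPf v0) in v_in.
have : w \in (linfun ev @: U)%VS by rewrite imU memvf.
by move=> /memv_imgP[A UA ->]; exists A.
Qed.

Lemma exists_free_span_repr : (0 < d)%N -> exists s : seq G,
  free (map rho (1%g :: s)) /\ forall g, rho g \in <<map rho (1%g :: s)>>%VS.
Proof.
move=> d_gt0.
pose is_size k := `[< exists s, size s = k /\ free (map rho (1%g :: s)) >].
have exists_size : exists k, is_size k.
  exists 0; apply/asboolP; exists [::]; rewrite /= seq1_free repr_mx1.
  by split=> //; rewrite -mxrank_eq0 mxrank1 -lt0n.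
have size_le k : is_size k -> (k <= \dim {:'M[F]_d})%N.
  move=> /asboolP[s [<- free_s]].
  apply: leq_trans (dimvS (subvf <<map rho (1%g :: s)>>)).
  by rewrite (eqP free_s) size_map.
have [k /asboolP[s [size_s free_s]] size_max] := ex_maxnP exists_size size_le.
exists s; split=> // g; apply: contraTT isT => rho_g.
suff : (size (g :: s) <= size s)%N by rewrite ltnn.
rewrite size_s; apply: size_max; apply/asboolP; exists (g :: s); split=> //.
have perm_gs : perm_eq (map rho [:: 1%g, g & s]) (map rho [:: g, 1%g & s]).
  by apply: perm_map; rewrite (perm_catCA [:: 1%g] [:: g]).
by rewrite (perm_free perm_gs) /= free_cons rho_g.
Qed.

Lemma basis_irreducible (gs : 'I_(d * d) -> G) :
  (0 < d)%N -> is_basis (rho \o gs) -> irreducible rho.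
Proof.
move=> d_gt0 b_rho; split; first by move=> g v _; apply: memvf.
  by move/eqP; rewrite -dimv_eq0 dimvf /dim /= muln1 -leqn0 leqNgt d_gt0.
move=> V invV _; have [->|V0] := eqVneq V 0%VS; [by left | right].
have VM A v : v \in V -> A *m v \in V.
  move=> Vv; rewrite -(coordsK b_rho A) mulmx_suml; apply: memv_suml => k _.
  by rewrite -scalemxAl memvZ //; apply: invV.
have [k [o]] : exists k o, vpick V k o != 0 by apply: exists_entry_neq0; rewrite vpick0.
rewrite (ord1 o) => vk0; apply/vspaceP => w; rewrite memvf.
have -> : w = (w *m delta_mx 0 k) *m ((vpick V k 0)^-1 *: vpick V).
  rewrite -mulmxA mul_delta_mx_col mxE mulVf // scale1r.
  by rewrite -colE; apply/colP => i; rewrite mxE.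
by rewrite VM // memvZ // memv_pick.
Qed.

End Field.

Lemma basis_absolutely_irreducible (F : fieldType) (rho : representation G d F)
    (gs : 'I_(d * d) -> G) :
  (0 < d)%N -> is_basis (rho \o gs) -> absolutely_irreducible rho.
Proof.
move=> d_gt0 b_rho E f; apply: (@basis_irreducible _ _ gs) => //.
by rewrite (is_basis_map f (rho \o gs)).
Qed.

Lemma irreducible_exists_basis (L : closedFieldType) (rho : representation G d L) :
  irreducible rho ->
  exists (gs : 'I_(d * d) -> G) i0, gs i0 = 1%g /\ is_basis (rho \o gs).
Proof.
move=> irr; have d_gt0 := irreducible_dim_gt0 irr.
have [s [free_s rho_s]] := exists_free_span_repr rho d_gt0.
set S := map rho _ in free_s rho_s.
have SM : mul_closed <<S>>.
  apply: span_mul_closed => _ _ /mapP[g _ ->] /mapP[h _ ->].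
  by rewrite -repr_mxM rho_s.
have S1 : 1%:M \in <<S>>%VS by rewrite -(repr_mx1 rho) rho_s.
have S_full : <<S>>%VS = fullv.
  apply: (burnside SM); apply: (irreducible_vector_transitive irr S1) => g A.
  exact: SM.
have size_S : size S = (d * d)%N by rewrite -(eqP free_s) S_full dimvf.
have dd_gt0 : (0 < d * d)%N by rewrite muln_gt0 d_gt0.
exists (fun i => nth 1%g (1%g :: s) i), (Ordinal dd_gt0); split=> //.
rewrite /is_basis (_ : tval _ = S) ?/basis_of ?S_full ?eqxx //.
apply: (@eq_from_nth _ 0) => [|i]; rewrite size_tuple // => i_lt.
rewrite -[i]/(nat_of_ord (Ordinal i_lt)) nth_mktuple /S (nth_map 1%g) //.
by rewrite -(size_map rho) size_S.
Qed.

(* The linear map sending the basis [sigma \o gs] to [tau \o gs] sends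
   [sigma g] to [tau g], so it is an algebra endomorphism. *)
Lemma conjugate_of_coords (F : fieldType) (sigma tau : representation G d F)
    (gs : 'I_(d * d) -> G) :
  is_basis (sigma \o gs) ->
  (forall g, tau g = lincomb (tau \o gs) (coords (sigma \o gs) (sigma g))) ->
  exists2 P, P \in unitmx & forall g, conj_mx P (tau g) = sigma g.
Proof.
move=> b_sigma tauE.
pose phi : {linear 'M[F]_d -> 'M[F]_d} := lincomb (tau \o gs) \o coords (sigma \o gs).
have phi_sigma g : phi (sigma g) = tau g by rewrite [RHS]tauE.
have phi1 : phi 1%:M = 1%:M by rewrite -{1}(repr_mx1 sigma) phi_sigma repr_mx1.
have phiM : {morph phi : A B / A *m B}.
  move=> A B; rewrite -(coordsK b_sigma A) -(coordsK b_sigma B).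
  move: (coords _ A) (coords _ B) => a b; rewrite [in LHS]lincomb_mulr.
  rewrite !(linear_lincomb phi) lincomb_mulr; apply: eq_lincomb => i.
  rewrite [in LHS]lincomb_mull (linear_lincomb phi) lincomb_mull.
  apply: eq_lincomb => j.
  by rewrite -repr_mxM !phi_sigma repr_mxM.
have [P uP phiP] := skolem_noether phi1 phiM.
by exists P => // g; rewrite -phi_sigma phiP.
Qed.

End IrreducibleRepresentations.

(** * Coordinates determined by traces *)

Lemma map_mulc (F E : fieldType) (f : {rmorphism F -> E}) n
    (c : 'I_n -> 'I_n -> 'rV[F]_n) x y :
  map_mx f (mulc c x y)
  = mulc (fun i j => map_mx f (c i j)) (map_mx f x) (map_mx f y).
Proof. by rewrite map_lincomb; apply: eq_lincomb => i; rewrite map_lincomb. Qed.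

Lemma eq_mulc (F : fieldType) n (c c' : 'I_n -> 'I_n -> 'rV[F]_n) x y :
  (forall i j, c i j = c' i j) -> mulc c x y = mulc c' x y.
Proof. by move=> cc'; apply: eq_lincomb => i; apply: eq_lincomb => j. Qed.

Lemma separable_table_descent (F E : fieldType) (f : {rmorphism F -> E}) n
    (c : 'I_n -> 'I_n -> 'rV[F]_n) W i0 :
  separable_table (fun i j => map_mx f (c i j)) (map_mx f W) i0 ->
  separable_table c W i0.
Proof.
case=> cA c1 W1 Wc; split=> [i j k|j||i k l].
- by apply: (map_mx_inj (f := f)); rewrite !map_lincomb cA.
- by apply: (map_mx_inj (f := f)); rewrite c1 map_delta_mx.
- by apply: (map_mx_inj (f := f)); rewrite map_bilincomb W1 map_delta_mx.
apply: (fmorph_inj f); rewrite !rmorph_sum; have := Wc i k l.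
under eq_bigr do rewrite !mxE -rmorphM; move=> ->.
by apply: eq_bigr => j _; rewrite !mxE -rmorphM.
Qed.

Lemma conjugate_of_trace (F : fieldType) (G : groupType) d
    (sigma tau : representation G d F) (gs : 'I_(d * d) -> G) :
  is_basis (sigma \o gs) -> (forall g, \tr (tau g) = \tr (sigma g)) ->
  exists2 P, P \in unitmx & forall g, conj_mx P (tau g) = sigma g.
Proof.
move=> b_sigma tr_tau.
have gram_tau : gram (tau \o gs) = gram (sigma \o gs).
  by apply/matrixP => i j; rewrite !mxE -!repr_mxM tr_tau.
have b_tau : is_basis (tau \o gs) by rewrite is_basis_gram gram_tau -is_basis_gram.
apply: conjugate_of_coords (b_sigma) _ => g.
rewrite -{1}(coordsK b_tau (tau g)) !coords_gram // gram_tau.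
by congr (lincomb _ (_ *m _)); apply/rowP => j; rewrite !mxE -!repr_mxM tr_tau.
Qed.

Section TraceCoordinates.
Variables (K : fieldType) (G : groupType) (d : nat) (gs : 'I_(d * d) -> G).
Implicit Types (T : G -> K) (g h : G).

Definition trace_gram T : 'M[K]_(d * d) := \matrix_(i, j) T (gs i * gs j)%g.

Definition trace_coords T g : 'rV[K]_(d * d) :=
  (\row_j T (g * gs j)%g) *m invmx (trace_gram T).

Definition trace_table T i j := trace_coords T (gs i * gs j)%g.

Definition trace_sep T : 'M[K]_(d * d) := d%:R^-1 *: invmx (trace_gram T).

Variables (E : fieldType) (iota : {rmorphism K -> E}).
Variables (sigma : representation G d E) (T : G -> K).
Hypothesis trT : forall g, \tr (sigma g) = iota (T g).

Lemma map_trace_gram : map_mx iota (trace_gram T) = gram (sigma \o gs).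
Proof. by apply/matrixP => i j; rewrite !mxE -repr_mxM trT. Qed.

Lemma is_basis_trace_gram : is_basis (sigma \o gs) = (trace_gram T \in unitmx).
Proof. by rewrite is_basis_gram -map_trace_gram map_unitmx. Qed.

Hypothesis b_sigma : is_basis (sigma \o gs).

Lemma map_trace_coords g :
  map_mx iota (trace_coords T g) = coords (sigma \o gs) (sigma g).
Proof.
rewrite map_mxM map_invmx map_trace_gram coords_gram //; congr (_ *m _).
by apply/rowP => j; rewrite !mxE -repr_mxM trT.
Qed.

Lemma map_trace_table i j :
  map_mx iota (trace_table T i j) = mul_table (sigma \o gs) i j.
Proof. by rewrite map_trace_coords repr_mxM. Qed.

Lemma lincomb_trace_coords g :
  sigma g = lincomb (sigma \o gs) (map_mx iota (trace_coords T g)).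
Proof. by rewrite map_trace_coords coordsK. Qed.

Lemma trace_coords_basis i : trace_coords T (gs i) = delta_mx 0 i.
Proof.
apply: (map_mx_inj (f := iota)).
by rewrite map_trace_coords coords_basis // map_delta_mx.
Qed.

Lemma trace_coordsM g h :
  trace_coords T (g * h)%g
  = mulc (trace_table T) (trace_coords T g) (trace_coords T h).
Proof.
apply: (map_mx_inj (f := iota)); rewrite map_mulc (eq_mulc _ _ map_trace_table).
apply: (can_inj (lincombK b_sigma)).
rewrite lincombM => [|i j]; last exact: mulmx_basis.
by rewrite -!lincomb_trace_coords repr_mxM.
Qed.

Lemma trace_separable_table i0 : gs i0 = 1%g -> d%:R != 0 :> K ->
  separable_table (trace_table T) (trace_sep T) i0.
Proof.
move=> gs0 d0; apply: (separable_table_descent (f := iota)).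
have -> : (fun i j => map_mx iota (trace_table T i j)) = mul_table (sigma \o gs).
  by apply/funext => i; apply/funext => j; rewrite map_trace_table.
rewrite map_mxZ fmorphV rmorph_nat map_invmx map_trace_gram.
apply: basis_separable_table => //; first by rewrite /= gs0 repr_mx1.
by rewrite -(rmorph_nat iota) fmorph_eq0.
Qed.

Lemma exists_trace_form i0 (f : 'I_(d * d) -> 'M[K]_d) :
  gs i0 = 1%g -> f i0 = 1%:M -> has_mul_table f (trace_table T) ->
  exists tau : representation G d K,
    (forall i, tau (gs i) = f i) /\ forall g, \tr (tau g) = T g.
Proof.
move=> gs0 f1 fM.
have tau1 : lincomb f (trace_coords T 1%g) = 1%:M.
  by rewrite -gs0 trace_coords_basis lincomb_delta.
have tauM g h : lincomb f (trace_coords T (g * h)%g)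
    = lincomb f (trace_coords T g) *m lincomb f (trace_coords T h).
  by rewrite trace_coordsM lincombM.
pose tau := Representation tau1 tauM; exists tau.
have tau_gs i : tau (gs i) = f i by rewrite /= trace_coords_basis lincomb_delta.
split=> // g; apply: (fmorph_inj iota); rewrite -trT -trace_map_mx.
have [|P uP <-] :=
    @conjugate_of_coords _ _ _ sigma (extend_scalars iota tau) gs b_sigma.
  move=> h; rewrite -map_trace_coords /= map_lincomb; apply: eq_lincomb => i.
  by rewrite -tau_gs.
by rewrite mxtrace_conj_mx.
Qed.

End TraceCoordinates.

(** * Absolute values and uniform limits *)

Section AbsoluteValue.
Variables (R : realType) (K : completeValuedFieldType R).
Implicit Types x y : K.

Lemma absv0 : absv (0 : K) = 0.
Proof. by apply/absv_eq0. Qed.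

Lemma absv_neq0 x : x != 0 -> absv x != 0.
Proof. by apply: contra_neq => /absv_eq0. Qed.

Lemma absv_gt0 x : x != 0 -> 0 < absv x.
Proof. by move=> x0; rewrite lt0r absv_neq0 // absv_ge0. Qed.

Lemma absv1 : absv (1 : K) = 1.
Proof. by apply: (mulfI (absv_neq0 (oner_neq0 K))); rewrite -absvM !mulr1. Qed.

Lemma absvN x : absv (- x) = absv x.
Proof.
rewrite -mulN1r absvM; suff -> : absv (-1 : K) = 1 by rewrite mul1r.
apply/eqP; rewrite -(eqrXn2 (_ : 0 < 2)%N) ?absv_ge0 ?ler01 //.
by rewrite expr1n expr2 -absvM mulrNN mulr1 absv1.
Qed.

Lemma absvBC x y : absv (x - y) = absv (y - x).
Proof. by rewrite -opprB absvN. Qed.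

Lemma ler_absvB x y : absv (x - y) <= absv x + absv y.
Proof. by rewrite -(absvN y) ler_absvD. Qed.

Lemma absvV x : x != 0 -> absv x^-1 = (absv x)^-1.
Proof.
move=> x0; apply: (mulfI (absv_neq0 x0)).
by rewrite -absvM !divff ?absv1 // absv_neq0.
Qed.

Lemma cvg_absvP (u : nat -> K) (l : K) :
  u @ \oo --> l <->
  (forall e : R, 0 < e -> \forall n \near \oo, absv (u n - l) < e).
Proof.
split=> [/cvg_ballP ul e e0|ul].
  by near=> n; rewrite absvBC; apply/ball_absvE; near: n; apply: ul.
apply/cvg_ballP => e e0; near=> n.
by apply/ball_absvE; rewrite absvBC; near: n; apply: ul.
Unshelve. all: by end_near. Qed.

Lemma absv_hausdorff : hausdorff_space K.
Proof.
rewrite ball_hausdorff => x y xy; have xy2 : 0 < absv (x - y) / 2.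
  by rewrite divr_gt0 // absv_gt0 // subr_eq0.
exists (PosNum xy2, PosNum xy2) => /=; apply/eqP/seteqP; split=> // z [].
move=> /ball_absvE xz /ball_absvE yz; have := ltrD xz yz; rewrite -splitr ltNge.
by rewrite [absv (y - z)]absvBC (le_trans _ (ler_absvD _ _)) // addrA subrK.
Qed.

End AbsoluteValue.

Section BoundedFunctions.
Variables (R : realType) (K : completeValuedFieldType R) (I : Type).
Implicit Types f g : I -> K.

Definition absv_bounded f := exists B : R, forall i, absv (f i) <= B.

Lemma absv_bounded_ge0 f : absv_bounded f ->
  exists B : R, 0 <= B /\ forall i, absv (f i) <= B.
Proof.
by move=> [B fB]; exists `|B|; split=> // i; rewrite (le_trans (fB i)) ?ler_norm.
Qed.

Lemma absv_bounded_cst (a : K) : absv_bounded (fun=> a).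
Proof. by exists (absv a). Qed.

Lemma absv_boundedD f g : absv_bounded f -> absv_bounded g ->
  absv_bounded (fun i => f i + g i).
Proof.
move=> [A fA] [B gB]; exists (A + B) => i.
by rewrite (le_trans (ler_absvD _ _)) ?lerD.
Qed.

Lemma absv_boundedM f g : absv_bounded f -> absv_bounded g ->
  absv_bounded (fun i => f i * g i).
Proof.
by move=> [A fA] [B gB]; exists (A * B) => i; rewrite absvM ler_pM ?absv_ge0.
Qed.

Lemma absv_bounded_sum (J : Type) (r : seq J) (f : J -> I -> K) :
  (forall j, absv_bounded (f j)) -> absv_bounded (fun i => \sum_(j <- r) f j i).
Proof.
move=> bf; elim: r => [|j r IHr].
  by under eq_fun do rewrite big_nil; apply: absv_bounded_cst.
by under eq_fun do rewrite big_cons; apply: absv_boundedD.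
Qed.

Lemma absv_boundedN f : absv_bounded f -> absv_bounded (fun i => - f i).
Proof. by move=> [B fB]; exists B => i; rewrite absvN. Qed.

Lemma absv_boundedZ a f : absv_bounded f -> absv_bounded (fun i => a * f i).
Proof. exact/absv_boundedM/absv_bounded_cst. Qed.

End BoundedFunctions.

Lemma absv_bounded_comp (R : realType) (K : completeValuedFieldType R) (I J : Type)
    (h : J -> I) (f : I -> K) : absv_bounded f -> absv_bounded (fun j => f (h j)).
Proof. by move=> [B fB]; exists B => j. Qed.

Section UniformLimits.
Variables (R : realType) (K : completeValuedFieldType R).

Lemma uniform_absvP (I : choiceType) (F : nat -> I -> K) (f : I -> K) :
  {uniform, F @ \oo --> f} <->
  (forall e : R, 0 < e -> \forall n \near \oo, forall i, absv (F n i - f i) < e).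
Proof.
split=> [Ff e e0|Ff].
  have /Ff : nbhs (f : {uniform I -> K})
      [set h | forall i, absv (h i - f i) < e]; last by [].
  apply/uniform_nbhs; exists [set xy | ball xy.1 e xy.2]; split.
    by rewrite -entourage_ballE; exists e.
  by move=> h /= fh i; rewrite absvBC; apply/ball_absvE/fh.
move=> P /uniform_nbhs[E [entE EP]].
move: entE; rewrite -entourage_ballE => -[e /= e0 eE].
rewrite nbhs_filterE; apply: filterS (Ff e e0) => n Fn; apply: EP => i _.
by apply: eE => /=; apply/ball_absvE; rewrite absvBC.
Qed.

(* The limit is required to be bounded in order to have [ucvgM]. *)
Definition ucvg (I : choiceType) (F : nat -> I -> K) (f : I -> K) :=
  absv_bounded f /\ {uniform, F @ \oo --> f}.

Section Arithmetic.
Variable I : choiceType.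
Implicit Types (F G : nat -> I -> K) (f g : I -> K).

Lemma ucvg_cst f : absv_bounded f -> ucvg (fun=> f) f.
Proof.
move=> bf; split=> //; apply/uniform_absvP => e e0.
by apply: nearW => n i; rewrite subrr absv0.
Qed.

Lemma near_eq_uniform F F' f : (\forall n \near \oo, forall i, F n i = F' n i) ->
  {uniform, F @ \oo --> f} -> {uniform, F' @ \oo --> f}.
Proof.
move=> FF' /uniform_absvP Ff; apply/uniform_absvP => e e0.
by apply: filterS2 FF' (Ff e e0) => n FFn Fn i; rewrite -FFn.
Qed.

Lemma near_eq_ucvg F F' f : (\forall n \near \oo, forall i, F n i = F' n i) ->
  ucvg F f -> ucvg F' f.
Proof. by move=> FF' [bf Ff]; split=> //; apply: near_eq_uniform FF' Ff. Qed.

Lemma eq_ucvg F F' f f' : (forall n i, F n i = F' n i) ->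
  (forall i, f i = f' i) ->
  ucvg F f -> ucvg F' f'.
Proof. by move=> /funeq2P -> /funext ->. Qed.

Lemma ucvgD F G f g : ucvg F f -> ucvg G g ->
  ucvg (fun n i => F n i + G n i) (fun i => f i + g i).
Proof.
move=> [bf /uniform_absvP Ff] [bg /uniform_absvP Gg].
split; first exact: absv_boundedD.
apply/uniform_absvP => e e0; have e2 : 0 < e / 2 by rewrite divr_gt0.
apply: filterS2 (Ff _ e2) (Gg _ e2) => n Fn Gn i.
rewrite opprD addrACA (le_lt_trans (ler_absvD _ _)) //.
by rewrite [e]splitr ltrD.
Qed.

Lemma ucvgM F G f g : ucvg F f -> ucvg G g ->
  ucvg (fun n i => F n i * G n i) (fun i => f i * g i).
Proof.
move=> [bf /uniform_absvP Ff] [bg /uniform_absvP Gg].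
split; first exact: absv_boundedM.
have [A [A0 fA]] := absv_bounded_ge0 bf; have [B [B0 gB]] := absv_bounded_ge0 bg.
apply/uniform_absvP => e e0; pose M := 1 + B + A.
have M0 : 0 < M by rewrite !ltr_pwDl.
have t0 : 0 < Num.min 1 (e / M) by rewrite lt_min ltr01 divr_gt0.
apply: filterS2 (Ff _ t0) (Gg _ t0) => n Fn Gn i.
move: (Fn i) (Gn i); rewrite !lt_min => /andP[F1 Fe] /andP[G1 Ge].
have -> : F n i * G n i - f i * g i = (F n i - f i) * (G n i - g i)
    + (F n i - f i) * g i + f i * (G n i - g i) by ring.
have -> : e = (e / M) * 1 + (e / M) * B + A * (e / M).
  by rewrite /M in M0 *; field; rewrite gt_eqF.
rewrite (le_lt_trans (ler_absvD _ _)) // ltr_leD //; last first.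
  by rewrite absvM ler_pM ?absv_ge0 // ltW.
rewrite (le_lt_trans (ler_absvD _ _)) // ltr_leD //; last first.
  by rewrite absvM ler_pM ?absv_ge0 // ltW.
by rewrite absvM ltr_pM ?absv_ge0.
Qed.

Lemma ucvg_sum (J : Type) (r : seq J) (F : J -> nat -> I -> K) (f : J -> I -> K) :
  (forall j, ucvg (F j) (f j)) ->
  ucvg (fun n i => \sum_(j <- r) F j n i) (fun i => \sum_(j <- r) f j i).
Proof.
move=> Ff; elim: r => [|j r IHr].
  by apply: eq_ucvg (ucvg_cst (absv_bounded_cst I 0)) => *; rewrite big_nil.
by apply: eq_ucvg (ucvgD (Ff j) IHr) => *; rewrite big_cons.
Qed.

Lemma ucvg_prod (J : Type) (r : seq J) (F : J -> nat -> I -> K) (f : J -> I -> K) :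
  (forall j, ucvg (F j) (f j)) ->
  ucvg (fun n i => \prod_(j <- r) F j n i) (fun i => \prod_(j <- r) f j i).
Proof.
move=> Ff; elim: r => [|j r IHr].
  by apply: eq_ucvg (ucvg_cst (absv_bounded_cst I 1)) => *; rewrite big_nil.
by apply: eq_ucvg (ucvgM (Ff j) IHr) => *; rewrite big_cons.
Qed.

Lemma cvg_ucvg (u : nat -> K) (l : K) :
  u @ \oo --> l -> ucvg (fun n (_ : I) => u n) (fun=> l).
Proof.
move=> /cvg_absvP ul; split; first exact: absv_bounded_cst.
by apply/uniform_absvP => e /ul; apply: filterS.
Qed.

End Arithmetic.

Lemma ucvg_unit (u : nat -> K) (l : K) :
  ucvg (fun n (_ : unit) => u n) (fun=> l) -> u @ \oo --> l.
Proof.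
move=> [_ /uniform_absvP ul]; apply/cvg_absvP => e /ul.
by apply: filterS => n; apply; exact: tt.
Qed.

Lemma ucvg_comp (I J : choiceType) (h : J -> I) (F : nat -> I -> K) f :
  ucvg F f -> ucvg (fun n j => F n (h j)) (fun j => f (h j)).
Proof.
move=> [bf /uniform_absvP Ff]; split; first exact: absv_bounded_comp.
by apply/uniform_absvP => e /Ff; apply: filterS => n Fn j.
Qed.

Lemma cvg_absvV (u : nat -> K) (l : K) : l != 0 ->
  u @ \oo --> l -> (fun n => (u n)^-1) @ \oo --> l^-1.
Proof.
move=> l0 /cvg_absvP ul; apply/cvg_absvP => e e0; have al := absv_gt0 l0.
have l2 : 0 < absv l / 2 by rewrite divr_gt0.
have t0 : 0 < e * (absv l / 2 * absv l) by rewrite mulr_gt0 // mulr_gt0.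
apply: filterS2 (ul _ l2) (ul _ t0) => n unl unl'.
have un2 : absv l / 2 < absv (u n).
  have : absv l <= absv (u n) + absv (u n - l).
    by rewrite -{1}[l](subKr (u n)) ler_absvB.
  by move: unl; set a := absv (u n); set b := absv (u n - l); lra.
have un0 : u n != 0 by apply: contraTneq un2 => ->; rewrite absv0 -leNgt ltW.
have -> : (u n)^-1 - l^-1 = (l - u n) / (u n * l) by field; rewrite un0 l0.
rewrite absvM absvV ?mulf_neq0 // absvM ltr_pdivrMr ?mulr_gt0 ?absv_gt0 //.
by rewrite absvBC (lt_trans unl') // ltr_pM2l // ltr_pM2r.
Qed.

Section Matrices.
Variables (m : nat) (A : nat -> 'M[K]_m) (A0 : 'M[K]_m).
Hypothesis AA0 : forall i j, (fun n => A n i j) @ \oo --> A0 i j.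

Lemma cvg_det : (fun n => \det (A n)) @ \oo --> \det A0.
Proof.
apply: ucvg_unit; apply: ucvg_sum => s.
apply: ucvgM; first exact/ucvg_cst/absv_bounded_cst.
by apply: ucvg_prod => i; apply: cvg_ucvg.
Qed.

Lemma near_unitmx : A0 \in unitmx -> \forall n \near \oo, A n \in unitmx.
Proof.
rewrite unitmxE unitfE => d0.
have /cvg_absvP/(_ _ (absv_gt0 d0)) := cvg_det.
apply: filterS => n; rewrite unitmxE unitfE; apply: contraTneq => ->.
by rewrite sub0r absvN ltxx.
Qed.

End Matrices.

Lemma cvg_invmx m (A : nat -> 'M[K]_m) (A0 : 'M[K]_m) :
  (forall i j, (fun n => A n i j) @ \oo --> A0 i j) -> A0 \in unitmx ->
  forall i j, (fun n => invmx (A n) i j) @ \oo --> invmx A0 i j.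
Proof.
move=> AA0 u0 i j; apply: ucvg_unit.
apply: (@near_eq_ucvg _ (fun n _ => (\det (A n))^-1 * cofactor (A n) j i)).
  by apply: filterS (near_unitmx AA0 u0) => n un _; rewrite /invmx un !mxE.
rewrite /invmx u0 mxE [X in _ * X]mxE; apply: ucvgM.
  by apply/cvg_ucvg/cvg_absvV/cvg_det; rewrite // -unitfE -unitmxE.
apply: ucvgM; first exact/ucvg_cst/absv_bounded_cst.
apply/cvg_ucvg/cvg_det => a b; rewrite !mxE.
by under eq_fun do rewrite !mxE; apply: AA0.
Qed.

Lemma exists_geometric_lt (B e : R) : 0 < e -> exists n, B / 2 ^+ n < e.
Proof.
move=> e0; exists (Num.bound (B / e)).
by rewrite ltr_pdivrMr ?exprn_gt0 // -ltr_pdivrMl // mulrC upper_nthrootP.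
Qed.

Lemma ler_geometric0 (x B : R) : (forall n, x <= B / 2 ^+ n) -> x <= 0.
Proof.
move=> xB; rewrite leNgt; apply/negP => /(exists_geometric_lt B)[n].
by rewrite ltNge xB.
Qed.

Lemma geometric_cvg (u : nat -> K) (B : R) :
  (forall n, absv (u n.+1 - u n) <= B / 2 ^+ n) ->
  exists l, forall n, absv (l - u n) <= 2 * B / 2 ^+ n.
Proof.
move=> uB; pose v n : R := 2 * B / 2 ^+ n.
have vS n : v n.+1 = B / 2 ^+ n.
  by rewrite /v exprS; field; rewrite expf_neq0.
have v_ge0 n : 0 <= v n.
  by rewrite /v -mulrA mulr_ge0 // (le_trans (absv_ge0 _) (uB n)).
have uv n k : absv (u (n + k)%N - u n) <= v n - v (n + k)%N.
  elim: k => [|k IHk]; first by rewrite addn0 !subrr absv0.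
  have -> : u (n + k.+1)%N - u n = (u (n + k).+1 - u (n + k)%N) + (u (n + k)%N - u n).
    by rewrite addnS addrA subrK.
  apply: (le_trans (ler_absvD _ _)); have := uB (n + k)%N.
  have : v (n + k)%N = 2 * v (n + k).+1 by rewrite vS /v mulrA.
  by rewrite addnS -vS; lra.
have {}uv n k : absv (u (n + k)%N - u n) <= v n.
  by apply: (le_trans (uv n k)); rewrite lerBlDr lerDl.
have : cvg (u @ \oo).
  apply/cauchy_cvgP/cauchy_exP => e e0; have [n ne] := exists_geometric_lt (2 * B) e0.
  exists (u n); exists n => // m /= nm; apply/ball_absvE.
  by rewrite absvBC -(subnKC nm) (le_lt_trans (uv _ _)).
move=> /cvg_ex[l /cvg_absvP ul]; exists l => n; apply/ler_addgt0Pr => e e0.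
have [m _ um] := ul e e0; have ulm := um (n + m)%N (leq_addl _ _).
rewrite -(subrKA (u (n + m)%N)) addrC (le_trans (ler_absvD _ _)) //.
by rewrite lerD // absvBC ltW.
Qed.

End UniformLimits.

Lemma near_choice (T : Type) (A : set T) (P : nat -> T -> Prop) (x0 : T) :
  A x0 -> (\forall n \near \oo, exists2 x, A x & P n x) ->
  exists f : nat -> T, (forall n, A (f n)) /\ \forall n \near \oo, P n (f n).
Proof.
move=> Ax0 [m _ mP].
have exP n : exists x, A x /\ ((m <= n)%N -> P n x).
  have [/mP[x Ax Pnx]|_] := leqP m n; first by exists x.
  by exists x0.
have [f fP] := choice exP; exists f; split=> [n|]; first by case: (fP n).
by exists m => // n /= mn; have [_] := fP n; apply.
Qed.

Lemma ler_term_sum (R : numDomainType) (I : finType) (F : I -> R) i :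
  (forall j, 0 <= F j) -> F i <= \sum_j F j.
Proof. by move=> F0; rewrite (bigD1 i) //= lerDl sumr_ge0. Qed.

Lemma near_sum_lt (R : realType) (I : finType) (u : nat -> I -> R) :
  (forall i e, 0 < e -> \forall n \near \oo, u n i < e) ->
  forall e, 0 < e -> \forall n \near \oo, \sum_i u n i < e.
Proof.
move=> u0 e e0; pose t := e / (#|I|%:R + 1).
have I0 : 0 < #|I|%:R + 1 :> R by rewrite ltr_wpDl.
have t0 : 0 < t by rewrite divr_gt0.
have : \forall n \near \oo, forall i, u n i < t.
  by apply: filter_forall => i; apply: u0.
apply: filterS => n un; apply: (@le_lt_trans _ _ (#|I|%:R * t)).
  by rewrite mulr_natl -sumr_const; apply: ler_sum => i _; apply: ltW.
by rewrite /t mulrCA -ltr_pdivlMl // mulVf ?gt_eqF // ltr_pdivrMr // mul1r ltrDl.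
Qed.

(** * Newton iteration towards algebra morphisms *)

Section EntryNorms.
Variables (R : realType) (K : completeValuedFieldType R) (n : nat).
Implicit Types (x : 'rV[K]_n) (W : 'M[K]_n).

Definition row_norm x : R := \sum_k absv (x 0 k).

Definition entry_norm W : R := \sum_i row_norm (row i W).

Lemma row_norm_ge0 x : 0 <= row_norm x.
Proof. by apply: sumr_ge0 => k _; apply: absv_ge0. Qed.

Lemma entry_norm_ge0 W : 0 <= entry_norm W.
Proof. by apply: sumr_ge0 => i _; apply: row_norm_ge0. Qed.

Lemma ler_absv_row_norm x k : absv (x 0 k) <= row_norm x.
Proof. by apply: (ler_term_sum (F := fun j => absv (x 0 j))) => j; apply: absv_ge0. Qed.

End EntryNorms.

Section CoordinateNorm.
Variables (R : realType) (K : completeValuedFieldType R) (V : vectType K) (n : nat).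
Variable X : 'I_n -> V.

Definition coord_norm (v : V) : R := row_norm (coords X v).

Lemma coord_norm_ge0 v : 0 <= coord_norm v.
Proof. exact: row_norm_ge0. Qed.

Lemma coord_norm0 : coord_norm 0 = 0.
Proof. by rewrite /coord_norm /row_norm linear0 big1 // => k _; rewrite mxE absv0. Qed.

Lemma coord_normN v : coord_norm (- v) = coord_norm v.
Proof.
by rewrite /coord_norm linearN; apply: eq_bigr => k _; rewrite mxE absvN.
Qed.

Lemma ler_coord_normD u v : coord_norm (u + v) <= coord_norm u + coord_norm v.
Proof.
rewrite /coord_norm /row_norm -big_split; apply: ler_sum => k _.
by rewrite linearD mxE; apply: ler_absvD.
Qed.

Lemma ler_coord_normB u v : coord_norm (u - v) <= coord_norm u + coord_norm v.
Proof. by rewrite -(coord_normN v) ler_coord_normD. Qed.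

Lemma coord_normZ a v : coord_norm (a *: v) = absv a * coord_norm v.
Proof.
rewrite /coord_norm /row_norm mulr_sumr; apply: eq_bigr => k _.
by rewrite linearZ mxE absvM.
Qed.

Lemma ler_coord_norm_sum (I : Type) (r : seq I) (F : I -> V) :
  coord_norm (\sum_(i <- r) F i) <= \sum_(i <- r) coord_norm (F i).
Proof.
elim/big_ind2: _ => [|x a y b xa yb|//]; first by rewrite coord_norm0.
by apply: (le_trans (ler_coord_normD _ _)); apply: lerD.
Qed.

Lemma ler_coord_norm_lincomb m (Y : 'I_m -> V) x B :
  (forall k, coord_norm (Y k) <= B) ->
  coord_norm (lincomb Y x) <= row_norm x * B.
Proof.
move=> YB; apply: (le_trans (ler_coord_norm_sum _ _)); rewrite mulr_suml.
by apply: ler_sum => k _; rewrite coord_normZ ler_wpM2l ?absv_ge0.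
Qed.

Lemma ler_coord_norm_bilincomb m W (Z : 'I_m -> 'I_m -> V) B :
  (forall i j, coord_norm (Z i j) <= B) ->
  coord_norm (bilincomb W Z) <= entry_norm W * B.
Proof.
move=> ZB; rewrite bilincombE (le_trans (ler_coord_norm_sum _ _)) // mulr_suml.
by apply: ler_sum => i _; apply: ler_coord_norm_lincomb.
Qed.

Hypothesis bX : is_basis X.

Lemma coord_norm_lincomb x : coord_norm (lincomb X x) = row_norm x.
Proof. by rewrite /coord_norm lincombK. Qed.

Lemma coord_norm_basis k : coord_norm (X k) = 1.
Proof.
rewrite /coord_norm /row_norm coords_basis // (bigD1 k) //= mxE !eqxx absv1.
by rewrite big1 ?addr0 // => j jk; rewrite mxE (negPf jk) andbF absv0.
Qed.

Lemma coord_norm_le0 v : coord_norm v <= 0 -> v = 0.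
Proof.
move=> v0; rewrite -(coordsK bX v); suff -> : coords X v = 0 by rewrite linear0.
apply/rowP => k; rewrite [RHS]mxE; apply/absv_eq0/le_anti; rewrite absv_ge0 andbT.
exact: le_trans (ler_absv_row_norm _ k) v0.
Qed.

Lemma coord_norm_geometric_cvg (y : nat -> V) (B : R) :
  (forall m, coord_norm (y m.+1 - y m) <= B / 2 ^+ m) ->
  exists z, forall m, coord_norm (z - y m) <= n%:R * 2 * B / 2 ^+ m.
Proof.
move=> yB.
have coordB u v k : coords X (u - v) 0 k = coords X u 0 k - coords X v 0 k.
  by rewrite linearB !mxE.
have coord_cvg k :
    exists l, forall m, absv (l - coords X (y m) 0 k) <= 2 * B / 2 ^+ m.
  apply: geometric_cvg => m; rewrite -coordB.
  exact: le_trans (ler_absv_row_norm _ _) (yB m).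
have [l ly] := choice coord_cvg; exists (lincomb X (\row_k l k)) => m.
apply: (@le_trans _ _ (\sum_(k < n) 2 * B / 2 ^+ m)).
  by apply: ler_sum => k _; rewrite coordB lincombK // [X in X - _]mxE.
by rewrite sumr_const card_ord -[leLHS]mulr_natl !mulrA.
Qed.

End CoordinateNorm.

Lemma ler_coord_normM (R : realType) (K : completeValuedFieldType R) n d
    (X : 'I_n -> 'M[K]_d) M A B a b :
  is_basis X -> 0 <= M -> (forall i j, coord_norm X (X i *m X j) <= M) ->
  coord_norm X A <= a -> coord_norm X B <= b ->
  coord_norm X (A *m B) <= M * (a * b).
Proof.
move=> bX M0 XM Aa Bb; apply: (@le_trans _ _ (M * (coord_norm X A * coord_norm X B))).
  rewrite -{1}(coordsK bX A) -{1}(coordsK bX B) lincomb_mulr mulrC -mulrA.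
  apply: ler_coord_norm_lincomb => i; rewrite lincomb_mull.
  by apply: ler_coord_norm_lincomb => j.
by rewrite ler_wpM2l // ler_pM ?coord_norm_ge0.
Qed.

Section NewtonIdentity.
Variables (F : fieldType) (n d : nat).
Variables (c : 'I_n -> 'I_n -> 'rV[F]_n) (W : 'M[F]_n) (i0 : 'I_n).
Hypothesis sepW : separable_table c W i0.
Implicit Types f : 'I_n -> 'M[F]_d.

Definition defect f i j : 'M[F]_d := lincomb f (c i j) - f i *m f j.

Definition correction f k : 'M[F]_d := bilincomb W (fun i j => f i *m defect f j k).

Definition newton f k : 'M[F]_d := f k + correction f k.

Lemma lincomb_defect f i j : lincomb f (c i j) = f i *m f j + defect f i j.
Proof. by rewrite addrC subrK. Qed.

Lemma newton_unit f : f i0 = 1%:M -> newton f i0 = 1%:M.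
Proof.
move=> f1; rewrite /newton f1 /correction /bilincomb big1 ?addr0 // => i _.
rewrite big1 // => j _; rewrite /defect (table_unit sepW) lincomb_delta f1.
by rewrite mulmx1 subrr mulmx0 scaler0.
Qed.

Lemma defect_cocycle f i j k :
  lincomb (defect f i) (c j k)
  = defect f i j *m f k - f i *m defect f j k + lincomb (defect f ^~ k) (c i j).
Proof.
rewrite !lincombB -!(linear_lincomb (lincomb f)) /= (table_assoc sepW).
rewrite -lincomb_mull -lincomb_mulr !lincomb_defect !mulmxDl !mulmxDr mulmxA.
apply/matrixP => a b; rewrite !mxE; ring.
Qed.

Lemma bilincomb_mul f : f i0 = 1%:M ->
  bilincomb W (fun i j => f i *m f j) = 1%:M - bilincomb W (defect f).
Proof.
move=> f1; rewrite -f1 -[f i0]lincomb_delta -(sep_mul sepW).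
rewrite (linear_bilincomb (lincomb f)) -bilincombB; apply: eq_bilincomb => i j.
by rewrite /= lincomb_defect addrK.
Qed.

Lemma lincomb_correction f x y : f i0 = 1%:M ->
  lincomb (correction f) (c x y)
  = correction f x *m f y - (defect f x y - bilincomb W (defect f) *m defect f x y)
    + (f x *m correction f y
       + bilincomb W (fun i j => defect f x i *m defect f j y)).
Proof.
move=> f1; rewrite lincomb_bilincomb.
transitivity (bilincomb W (fun i j => f i *m defect f j x *m f y
    - f i *m f j *m defect f x y + lincomb (fun l => f i *m defect f l y) (c j x))).
  apply: eq_bilincomb => i j; rewrite -!lincomb_mull defect_cocycle.
  by rewrite mulmxDr mulmxBr !mulmxA.
rewrite bilincombD bilincombB -!bilincomb_mulr bilincomb_mul //.
rewrite (bilincomb_central _ _ sepW) mulmxBl mul1mx; congr (_ + _).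
rewrite bilincomb_mull -bilincombD; apply: eq_bilincomb => i j.
by rewrite -lincomb_mulr lincomb_defect mulmxDl mulmxA.
Qed.

(* The correction cancels the part of the defect that is linear in the defect. *)
Lemma defect_newton f x y : f i0 = 1%:M ->
  defect (newton f) x y
  = bilincomb W (defect f) *m defect f x y
    + bilincomb W (fun i j => defect f x i *m defect f j y)
    - correction f x *m correction f y.
Proof.
move=> f1; rewrite {1}/defect lincombD lincomb_correction // lincomb_defect.
rewrite /newton mulmxDl !mulmxDr.
by apply/matrixP => a b; rewrite !mxE; ring.
Qed.

End NewtonIdentity.

Definition newton_cst (R : realType) (K : completeValuedFieldType R) n
    (W : 'M[K]_n) (M : R) : R :=
  let w := entry_norm W in 2 * w * M + 4 * w ^+ 2 * M ^+ 3.

Lemma newton_cst_ge0 (R : realType) (K : completeValuedFieldType R) n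
    (W : 'M[K]_n) (M : R) : 0 <= M -> 0 <= newton_cst W M.
Proof. by move=> M0; rewrite addr_ge0 ?mulr_ge0 ?exprn_ge0 ?entry_norm_ge0. Qed.

Section NewtonIteration.
Variables (R : realType) (K : completeValuedFieldType R) (n d : nat).
Variables (c : 'I_n -> 'I_n -> 'rV[K]_n) (W : 'M[K]_n) (i0 : 'I_n).
Variables (X : 'I_n -> 'M[K]_d) (M : R).
Hypotheses (sepW : separable_table c W i0) (bX : is_basis X).
Hypothesis XM : forall i j, coord_norm X (X i *m X j) <= M.
Implicit Types f : 'I_n -> 'M[K]_d.

Let nu := coord_norm X.
Let w := entry_norm W.
Let C := newton_cst W M.

Let M_ge0 : 0 <= M.
Proof. exact: le_trans (coord_norm_ge0 _ _) (XM i0 i0). Qed.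

Let w_ge0 : 0 <= w. Proof. exact: entry_norm_ge0. Qed.

Let nuM A B a b : nu A <= a -> nu B <= b -> nu (A *m B) <= M * (a * b).
Proof. exact: ler_coord_normM. Qed.

Lemma newton_step_bounds f D : f i0 = 1%:M ->
  (forall i, nu (f i) <= 2) -> (forall i j, nu (defect c f i j) <= D) ->
  (forall k, nu (correction c W f k) <= C * D) /\
  (forall i j, nu (defect c (newton c W f) i j) <= C * D ^+ 2).
Proof.
move=> f1 f2 fD; have D0 : 0 <= D := le_trans (coord_norm_ge0 _ _) (fD i0 i0).
have corrD k : nu (correction c W f k) <= w * (M * (2 * D)).
  by apply: ler_coord_norm_bilincomb => i j; apply: nuM.
split=> [k|x y].
  apply: (le_trans (corrD k)); have -> : w * (M * (2 * D)) = 2 * w * M * D by ring.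
  by rewrite [leRHS]mulrDl lerDl !mulr_ge0 ?exprn_ge0.
rewrite (defect_newton sepW) // (le_trans (ler_coord_normB _ _ _)) //.
have -> : C * D ^+ 2 = M * (w * D * D) + w * (M * (D * D))
    + M * ((w * (M * (2 * D))) * (w * (M * (2 * D)))).
  by rewrite /C /newton_cst -/w; ring.
apply: lerD; last exact: nuM.
apply: (le_trans (ler_coord_normD _ _ _)); apply: lerD.
  by apply: nuM => //; apply: ler_coord_norm_bilincomb.
by apply: ler_coord_norm_bilincomb => i j; apply: nuM.
Qed.

Lemma ler_defectB f f' i j e b : (forall k, nu (f k - f' k) <= e) ->
  nu (f j) <= b -> nu (f' i) <= 2 ->
  nu (defect c f i j - defect c f' i j)
  <= row_norm (c i j) * e + M * (e * b) + M * (2 * e).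
Proof.
move=> ff' fb f'2.
have -> : defect c f i j - defect c f' i j = lincomb (fun k => f k - f' k) (c i j)
    - ((f i - f' i) *m f j + f' i *m (f j - f' j)).
  rewrite lincombB /defect mulmxBl mulmxBr.
  by apply/matrixP => a a'; rewrite !mxE; ring.
rewrite -addrA (le_trans (ler_coord_normB _ _ _)) // lerD //.
  exact: ler_coord_norm_lincomb.
by rewrite (le_trans (ler_coord_normD _ _ _)) // lerD ?nuM.
Qed.

Variable D : R.
Hypotheses (X1 : X i0 = 1%:M) (XD : forall i j, nu (defect c X i j) <= D).
Hypothesis CD_le : C * D <= 2^-1.

Let C_ge0 : 0 <= C. Proof. exact: newton_cst_ge0. Qed.
Let D_ge0 : 0 <= D. Proof. exact: le_trans (coord_norm_ge0 _ _) (XD i0 i0). Qed.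

Definition newton_iter m := iter m (newton c W) X.

Lemma newton_iter_bounds m :
  [/\ newton_iter m i0 = 1%:M,
      forall i, nu (newton_iter m i) <= 2 - (2 ^+ m)^-1
    & forall i j, nu (defect c (newton_iter m) i j) <= D / 2 ^+ m].
Proof.
elim: m => [|m [F1 FX FD]].
  by split=> // [i|i j]; rewrite expr0 ?divr1 //= invr1 /nu coord_norm_basis //; lra.
have e_gt0 : 0 < (2 ^+ m)^-1 :> R by rewrite invr_gt0 exprn_gt0.
have eS : (2 ^+ m.+1)^-1 = 2^-1 * (2 ^+ m)^-1 :> R by rewrite exprS invfM.
have e_le1 : (2 ^+ m)^-1 <= 1 :> R.
  by rewrite invf_le1 ?exprn_gt0 // exprn_ege1 // ler1n.
have F2 i : nu (newton_iter m i) <= 2 by rewrite (le_trans (FX i)) // gerBl ltW.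
have [corr FD'] := newton_step_bounds F1 F2 FD; split=> [|i|i j].
- exact: newton_unit.
- apply: (le_trans (ler_coord_normD _ _ _)); apply: (le_trans (lerD (FX i) (corr i))).
  by have := ler_wpM2r (ltW e_gt0) CD_le; rewrite eS mulrA; lra.
have -> : D / 2 ^+ m.+1 = 2^-1 * (1 * (D / 2 ^+ m)) by rewrite eS; ring.
apply: (le_trans (FD' i j)).
have -> : C * (D / 2 ^+ m) ^+ 2 = (C * D) * ((2 ^+ m)^-1 * (D / 2 ^+ m)) by ring.
have De_ge0 : 0 <= D / 2 ^+ m by rewrite mulr_ge0 // ltW.
by rewrite ler_pM ?mulr_ge0 ?ler_wpM2r // ltW.
Qed.

Lemma newton_iter_le2 m i : nu (newton_iter m i) <= 2.
Proof.
have [_ /(_ i) Fi _] := newton_iter_bounds m.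
by rewrite (le_trans Fi) // gerBl invr_ge0 exprn_ge0.
Qed.

Lemma newton_iter_cvg i :
  exists y, forall m, nu (y - newton_iter m i) <= n%:R * 2 * (C * D) / 2 ^+ m.
Proof.
apply: coord_norm_geometric_cvg => // m; have [F1 _ FD] := newton_iter_bounds m.
have [corr _] := newton_step_bounds F1 (newton_iter_le2 m) FD.
by rewrite /= {1}/newton addrC addKr -mulrA; apply: corr.
Qed.

(* The algebra spanned by [X], whose multiplication table is close to [c], is
   isomorphic to the separable algebra with table [c]. *)
Theorem mul_table_rigidity : exists f, [/\ f i0 = 1%:M, has_mul_table f c
  & forall i, nu (f i - X i) <= n%:R * 2 * (C * D)].
Proof.
have [f fF] := choice newton_iter_cvg; set B := n%:R * 2 * (C * D) in fF *.
exists f; split=> [|i j|i]; last by have := fF i 0; rewrite expr0 divr1.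
  apply/eqP; rewrite -subr_eq0; apply/eqP/(coord_norm_le0 bX).
  apply: (@ler_geometric0 _ _ B) => m.
  by have [<- _ _] := newton_iter_bounds m; apply: fF.
apply/esym/eqP; rewrite -subr_eq0; apply/eqP/(coord_norm_le0 bX).
pose S := row_norm (c i j) * B + M * (B * nu (f j)) + M * (2 * B).
apply: (@ler_geometric0 _ _ (S + D)) => m; have [_ _ FD] := newton_iter_bounds m.
rewrite -/(defect c f i j) -(subrK (defect c (newton_iter m) i j) (defect c f i j)).
rewrite mulrDl (le_trans (ler_coord_normD _ _ _)) // lerD //.
apply: (le_trans (ler_defectB (fF^~ m) (lexx _) (newton_iter_le2 m i))).
by rewrite le_eqVlt; apply/orP; left; apply/eqP; rewrite /S; field; rewrite expf_neq0.
Qed.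

End NewtonIteration.

(** * Limits of representations *)

Lemma natr_neq0_pchar (K : fieldType) d : (0 < d)%N ->
  (forall p : nat, p \in [pchar K] -> (d < p)%N) -> d%:R != 0 :> K.
Proof.
move=> d0 charK; apply/negP => dK0; have [p pK] := natf0_pchar d0 dK0.
by have := charK p pK; rewrite ltnNge dvdn_leq // (dvdn_pcharf pK).
Qed.

Lemma conj_mx_coords (K : fieldType) (G : groupType) d
    (sigma tau : representation G d K) (gs : 'I_(d * d) -> G) P A :
  is_basis (tau \o gs) -> (forall g, conj_mx P (tau g) = sigma g) ->
  conj_mx P A = lincomb (sigma \o gs) (coords (tau \o gs) A).
Proof.
move=> b_tau tauP; rewrite -{1}(coordsK b_tau A) conj_mx_lincomb.
by apply: eq_lincomb => k; rewrite /= tauP.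
Qed.

Definition table_norm (R : realType) (K : completeValuedFieldType R) n
    (c : 'I_n -> 'I_n -> 'rV[K]_n) : R :=
  \sum_i \sum_j row_norm (c i j).

Lemma table_norm_ge0 (R : realType) (K : completeValuedFieldType R) n
    (c : 'I_n -> 'I_n -> 'rV[K]_n) : 0 <= table_norm c.
Proof. by apply: sumr_ge0 => i _; apply: sumr_ge0 => j _; apply: row_norm_ge0. Qed.

Lemma ler_table_norm (R : realType) (K : completeValuedFieldType R) n
    (c : 'I_n -> 'I_n -> 'rV[K]_n) i j :
  row_norm (c i j) <= table_norm c.
Proof.
apply: (@le_trans _ _ (\sum_j' row_norm (c i j'))).
  apply: (ler_term_sum (F := fun j' => row_norm (c i j'))) => j'.
  exact: row_norm_ge0.
apply: (ler_term_sum (F := fun i' => \sum_j' row_norm (c i' j'))) => i'.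
by apply: sumr_ge0 => j' _; apply: row_norm_ge0.
Qed.

Section LimitOfRepresentations.
Variables (R : realType) (K : completeValuedFieldType R) (G : groupType) (d : nat).
Variables (L : fieldType) (iota : {rmorphism K -> L}).
Variables (rhos : nat -> representation G d K) (rho : representation G d L).
Variables (T : G -> K) (gs : 'I_(d * d) -> G).
Hypothesis trT : forall g, \tr (rho g) = iota (T g).
Hypothesis b_rho : is_basis (rho \o gs).
Hypothesis TnT : forall g, (fun n => \tr (rhos n g)) @ \oo --> T g.

Let Tn n g := \tr (rhos n g).
Let X n := rhos n \o gs.
Let c := trace_table gs T.
Let W := trace_sep gs T.

Let trTn n g : \tr (rhos n g) = idfun (Tn n g). Proof. by []. Qed.

Let trace_gram_unitmx : trace_gram gs T \in unitmx.
Proof. by rewrite -(is_basis_trace_gram gs trT). Qed.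

Lemma cvg_trace_gram i j :
  (fun n => trace_gram gs (Tn n) i j) @ \oo --> trace_gram gs T i j.
Proof. by rewrite mxE; under eq_fun do rewrite mxE; apply: TnT. Qed.

Lemma near_is_basis : \forall n \near \oo, is_basis (X n).
Proof.
apply: filterS (near_unitmx cvg_trace_gram trace_gram_unitmx) => n.
by rewrite -(is_basis_trace_gram gs (trTn n)).
Qed.

Lemma cvg_trace_coords g k :
  (fun n => trace_coords gs (Tn n) g 0 k) @ \oo --> trace_coords gs T g 0 k.
Proof.
apply: ucvg_unit; rewrite mxE; under eq_fun do rewrite mxE.
apply: ucvg_sum => l; apply: ucvgM; apply: cvg_ucvg.
  by rewrite mxE; under eq_fun do rewrite mxE; apply: TnT.
exact: cvg_invmx cvg_trace_gram trace_gram_unitmx l k.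
Qed.

Let dist n := table_norm (fun i j => c i j - trace_table gs (Tn n) i j).

Lemma near_dist_lt e : 0 < e -> \forall n \near \oo, dist n < e.
Proof.
move: e; apply: near_sum_lt => i; apply: near_sum_lt => j.
apply: near_sum_lt => k e; have /cvg_absvP := @cvg_trace_coords (gs i * gs j)%g k.
by move=> /[apply]; apply: filterS => n; rewrite absvBC !mxE.
Qed.

Let M := 1 + table_norm c.
Let B := (d * d)%:R * 2 * newton_cst W M.

Lemma defect_repr n i j : is_basis (X n) ->
  defect c (X n) i j = lincomb (X n) (c i j - trace_table gs (Tn n) i j).
Proof.
move=> bX; rewrite linearB /defect /X /= -repr_mxM; congr (_ - _).
by rewrite [LHS](lincomb_trace_coords (trTn n) bX) map_mx_id.
Qed.

Lemma ler_coord_norm_repr_defect n i j : is_basis (X n) ->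
  coord_norm (X n) (defect c (X n) i j) <= dist n.
Proof.
move=> bX; rewrite defect_repr // coord_norm_lincomb //.
exact: (ler_table_norm (fun i j => c i j - trace_table gs (Tn n) i j)).
Qed.

Lemma ler_coord_norm_repr_mul n i j : is_basis (X n) -> dist n < 1 ->
  coord_norm (X n) (X n i *m X n j) <= M.
Proof.
move=> bX dist1.
have -> : X n i *m X n j = lincomb (X n) (c i j) - defect c (X n) i j.
  by rewrite lincomb_defect addrK.
rewrite (le_trans (ler_coord_normB _ _ _)) // /M addrC lerD //.
  by rewrite (le_trans (ler_coord_norm_repr_defect _ _ bX)) // ltW.
by rewrite coord_norm_lincomb // ler_table_norm.
Qed.

Variable i0 : 'I_(d * d).
Hypotheses (gs0 : gs i0 = 1%g) (d_neq0 : d%:R != 0 :> K).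

Let close_form n (tau : representation G d K) := (forall g, \tr (tau g) = T g) /\
  forall i, coord_norm (X n) (tau (gs i) - rhos n (gs i)) <= B * dist n.

Lemma near_close_form : \forall n \near \oo, exists tau, close_form n tau.
Proof.
set C := newton_cst W M; have C_ge0 : 0 <= C.
  by rewrite newton_cst_ge0 // addr_ge0 ?table_norm_ge0.
have t0 : 0 < 2^-1 / (C + 1) by rewrite divr_gt0 ?invr_gt0 // ltr_wpDl.
apply: filterS3 near_is_basis (near_dist_lt ltr01) (near_dist_lt t0).
move=> n bX dist1 dist_t.
have X1 : X n i0 = 1%:M by rewrite /X /= gs0 repr_mx1.
have Cdist : C * dist n <= 2^-1.
  have := table_norm_ge0 (fun i j => c i j - trace_table gs (Tn n) i j).
  by move: dist_t; rewrite ltr_pdivlMr ?ltr_wpDl // -/(dist n); lra.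
have sepW := trace_separable_table trT b_rho gs0 d_neq0.
have XM i j := ler_coord_norm_repr_mul i j bX dist1.
have XD i j := ler_coord_norm_repr_defect i j bX.
have [f [f1 fM fX]] := mul_table_rigidity sepW bX XM X1 XD Cdist.
have [tau [tau_gs tr_tau]] := exists_trace_form trT b_rho gs0 f1 fM.
by exists tau; split=> // i; rewrite tau_gs /B -mulrA; apply: fX.
Qed.

Lemma exists_trace_forms : exists tau : nat -> representation G d K,
  (\forall n \near \oo, forall g, \tr (tau n g) = T g) /\
  forall i k, (fun n => coords (X n) (tau n (gs i)) 0 k) @ \oo --> (i == k)%:R.
Proof.
have [|tau [_ tauP]] := @near_choice _ setT close_form (rhos 0) I.
  by apply: filterS near_close_form => n [tau tauP]; exists tau.
exists tau; split=> [|i k]; first by apply: filterS tauP => n [].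
have B_ge0 : 0 <= B by rewrite !mulr_ge0 ?newton_cst_ge0 ?addr_ge0 ?table_norm_ge0.
have B1 : 0 < B + 1 by rewrite ltr_wpDl.
apply/cvg_absvP => e e0; have t0 : 0 < e / (B + 1) by rewrite divr_gt0.
apply: filterS3 tauP near_is_basis (near_dist_lt t0) => n [_ tauX] bX dist_t.
have -> : (i == k)%:R = coords (X n) (rhos n (gs i)) 0 k.
  by rewrite (coords_basis i bX) mxE eqxx eq_sym.
have -> : coords (X n) (tau n (gs i)) 0 k - coords (X n) (rhos n (gs i)) 0 k
    = coords (X n) (tau n (gs i) - rhos n (gs i)) 0 k by rewrite linearB !mxE.
rewrite (le_lt_trans (ler_absv_row_norm _ _)) // (le_lt_trans (tauX i)) //.
move: dist_t; rewrite ltr_pdivlMr // mulrC; apply: le_lt_trans.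
by rewrite ler_wpM2r ?table_norm_ge0 // lerDl.
Qed.

Lemma is_basis_trace_form (tau : representation G d K) :
  (forall g, \tr (tau g) = T g) -> is_basis (tau \o gs).
Proof. by move=> tr_tau; rewrite (is_basis_trace_gram (iota := idfun) gs tr_tau). Qed.

Lemma coords_trace_form n (tau : representation G d K) g :
  is_basis (X n) -> (forall g, \tr (tau g) = T g) ->
  coords (tau \o gs) (rhos n g)
  = (\row_i \sum_k coords (X n) (tau (gs i)) 0 k * Tn n (g * gs k)%g)
    *m invmx (trace_gram gs T).
Proof.
move=> bX tr_tau; rewrite coords_gram ?is_basis_trace_form //.
rewrite -(map_trace_gram (iota := idfun) gs tr_tau) map_mx_id //; congr (_ *m _).
apply/rowP => i; rewrite !mxE /= -{1}(coordsK bX (tau (gs i))) lincomb_mull.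
by rewrite mxtrace_lincomb; apply: eq_bigr => k _; rewrite /X /= -repr_mxM.
Qed.

Lemma ucvg_conj_mx (sigma : representation G d K) (tau : nat -> representation G d K)
    (P : nat -> 'M[K]_d) (J : choiceType) (h : J -> G) :
  (forall g, \tr (sigma g) = T g) ->
  (\forall n \near \oo, (forall g, \tr (tau n g) = T g) /\
     forall g, conj_mx (P n) (tau n g) = sigma g) ->
  (forall i k, (fun n => coords (X n) (tau n (gs i)) 0 k) @ \oo --> (i == k)%:R) ->
  (forall k, ucvg (fun n j => Tn n (h j * gs k)%g) (fun j => T (h j * gs k)%g)) ->
  forall a b, ucvg (fun n j => conj_mx (P n) (rhos n (h j)) a b)
                   (fun j => sigma (h j) a b).
Proof.
move=> tr_sigma near_tau tau_cvg hT a b; pose I := invmx (trace_gram gs T).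
apply: (@near_eq_ucvg _ _ _ (fun n j => \sum_l (\sum_i
    (\sum_k coords (X n) (tau n (gs i)) 0 k * Tn n (h j * gs k)%g) * I i l)
      * sigma (gs l) a b)).
  apply: filterS2 near_is_basis near_tau => n bX [tr_tau tauP] j.
  rewrite (conj_mx_coords _ (is_basis_trace_form tr_tau) tauP) coords_trace_form //.
  rewrite summxE; apply: eq_bigr => l _; rewrite [RHS]mxE; congr (_ * _).
  by rewrite mxE; apply: eq_bigr => i _; rewrite mxE.
apply: (@eq_ucvg _ _ _ _ _ (fun j => \sum_l (\sum_i
    (\sum_k (i == k)%:R * T (h j * gs k)%g) * I i l) * sigma (gs l) a b)) => [//|j|].
  have b_sigma := is_basis_trace_form tr_sigma.
  rewrite [in RHS](lincomb_trace_coords (iota := idfun) tr_sigma b_sigma).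
  rewrite map_mx_id // summxE; apply: eq_bigr => l _; rewrite [RHS]mxE; congr (_ * _).
  rewrite mxE; apply: eq_bigr => i _; rewrite mxE (bigD1 i) //= eqxx mul1r.
  by rewrite big1 ?addr0 // => k ki; rewrite eq_sym (negPf ki) mul0r.
apply: ucvg_sum => l; apply: ucvgM; last exact/ucvg_cst/absv_bounded_cst.
apply: ucvg_sum => i; apply: ucvgM; last exact/ucvg_cst/absv_bounded_cst.
by apply: ucvg_sum => k; apply: ucvgM => //; apply: cvg_ucvg.
Qed.

Theorem exists_physical_limit :
  exists (sigma : representation G d K) (P : nat -> 'M[K]_d),
  [/\ forall g, \tr (sigma g) = T g, forall n, P n \in unitmx
    & forall (J : choiceType) (h : J -> G),
      (forall k, ucvg (fun n j => Tn n (h j * gs k)%g) (fun j => T (h j * gs k)%g)) ->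
      forall a b, ucvg (fun n j => conj_mx (P n) (rhos n (h j)) a b)
                       (fun j => sigma (h j) a b)].
Proof.
have [tau [[m _ tr_tau] tau_cvg]] := exists_trace_forms.
have tr_sigma := tr_tau m (leqnn m).
have [|P [uP PP]] := @near_choice _ [set P : 'M[K]_d | P \in unitmx]
    (fun n P => (forall g, \tr (tau n g) = T g) /\
       forall g, conj_mx P (tau n g) = tau m g) 1%:M (unitmx1 _ _).
  exists m => // n /= mn.
  have [g|P uP tauP] :=
      conjugate_of_trace (is_basis_trace_form tr_sigma) (tau := tau n).
    by rewrite tr_sigma tr_tau.
  by exists P; rewrite //; split=> //; apply: tr_tau.
by exists (tau m), P; split=> // J h hT a b; apply: ucvg_conj_mx PP tau_cvg hT a b.
Qed.

End LimitOfRepresentations.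

Section BoundedTraces.
Variables (R : realType) (K : completeValuedFieldType R) (G : groupType) (d : nat).
Variable gs : 'I_(d * d) -> G.

(* Bounded functions form a vector space, so [\tr (sigma g *m A *m Z *m B)] is
   bounded for all [A] and [B], and [1%:M] is a sum of matrices [A *m Z *m B]. *)
Lemma absv_bounded_trace_of_sandwich (sigma : representation G d K) (Z : 'M[K]_d) :
  is_basis (sigma \o gs) -> Z != 0 ->
  absv_bounded (fun xy : G * G => \tr (sigma xy.1 *m Z *m sigma xy.2)) ->
  absv_bounded (fun g => \tr (sigma g)).
Proof.
move=> b_sigma Z0 bZ; have [k [l Zkl]] := exists_entry_neq0 Z0.
have bAB A B : absv_bounded (fun g => \tr (sigma g *m (A *m Z *m B))).
  have -> : (fun g => \tr (sigma g *m (A *m Z *m B))) = (fun g =>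
      \sum_i coords (sigma \o gs) A 0 i * \sum_j coords (sigma \o gs) B 0 j *
        \tr (sigma (g * gs i)%g *m Z *m sigma (gs j))).
    apply/funext => g; rewrite -{1}(coordsK b_sigma A) -{1}(coordsK b_sigma B).
    rewrite !lincomb_mulr lincomb_mull mxtrace_lincomb; apply: eq_bigr => i _.
    rewrite !lincomb_mull mxtrace_lincomb; congr (_ * _); apply: eq_bigr => j _.
    by rewrite repr_mxM !mulmxA.
  apply: absv_bounded_sum => i; apply: absv_boundedZ; apply: absv_bounded_sum => j.
  apply: absv_boundedZ; exact: (absv_bounded_comp (fun g => (g * gs i, gs j)%g) bZ).
have -> : (fun g => \tr (sigma g)) = (fun g => \sum_b (Z k l)^-1 *
    \tr (sigma g *m (delta_mx b k *m Z *m delta_mx l b))).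
  apply/funext => g; rewrite -{1}[sigma g]mulmx1 mx1_sum_delta mulmx_sumr raddf_sum.
  apply: eq_bigr => b _; rewrite delta_mx_sandwich -scalemxAr mxtraceZ.
  by rewrite mulrA mulVf // mul1r.
by apply: absv_bounded_sum => b; apply: absv_boundedZ.
Qed.

Lemma absv_bounded_trace_sandwich (sigma tau : representation G d K) h :
  is_basis (sigma \o gs) ->
  absv_bounded (fun g => \tr (tau g) - \tr (sigma g)) ->
  absv_bounded (fun xy : G * G => \tr (tau xy.1 *m
    (tau h - lincomb (tau \o gs) (coords (sigma \o gs) (sigma h))) *m tau xy.2)).
Proof.
move=> b_sigma b_diff; set a := coords _ _.
have -> : (fun xy : G * G =>
      \tr (tau xy.1 *m (tau h - lincomb (tau \o gs) a) *m tau xy.2))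
    = (fun xy => (\tr (tau (xy.1 * h * xy.2)%g) - \tr (sigma (xy.1 * h * xy.2)%g))
        - \sum_i a 0 i * (\tr (tau (xy.1 * gs i * xy.2)%g)
                          - \tr (sigma (xy.1 * gs i * xy.2)%g))).
  apply/funext => -[x y] /=.
  have sandwich (mu : representation G d K) :
      \tr (mu x *m (mu h - lincomb (mu \o gs) a) *m mu y)
      = \tr (mu (x * h * y)%g) - \sum_i a 0 i * \tr (mu (x * gs i * y)%g).
    rewrite mulmxBr mulmxBl raddfB /= !repr_mxM lincomb_mull lincomb_mulr.
    rewrite mxtrace_lincomb; congr (_ - _).
    by apply: eq_bigr => i _; rewrite !repr_mxM.
  have := sandwich sigma; rewrite coordsK // subrr mulmx0 mul0mx raddf0.
  move=> /esym/eqP; rewrite subr_eq0 => /eqP sigma0.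
  under eq_bigr do rewrite mulrBr; rewrite sumrB sandwich sigma0.
  by ring.
apply: absv_boundedD.
  exact: (absv_bounded_comp (fun xy => xy.1 * h * xy.2)%g b_diff).
apply/absv_boundedN/absv_bounded_sum => i; apply: absv_boundedZ.
exact: (absv_bounded_comp (fun xy => xy.1 * gs i * xy.2)%g b_diff).
Qed.

Lemma bounded_trace_or_conjugate (sigma tau : representation G d K) :
  is_basis (sigma \o gs) -> is_basis (tau \o gs) ->
  absv_bounded (fun g => \tr (tau g) - \tr (sigma g)) ->
  absv_bounded (fun g => \tr (tau g)) \/
  exists2 P, P \in unitmx & forall g, conj_mx P (sigma g) = tau g.
Proof.
move=> b_sigma b_tau b_diff; pose a g := coords (sigma \o gs) (sigma g).
have [tauE|/existsNP[h /eqP tau_h]] :=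
    pselect (forall g, tau g = lincomb (tau \o gs) (a g)); [right | left].
  have [P uP tauP] := conjugate_of_coords b_sigma tauE; exists (invmx P).
    by rewrite unitmx_inv.
  by move=> g; rewrite -tauP conj_mxK.
have bZ := absv_bounded_trace_sandwich h b_sigma b_diff.
by apply: absv_bounded_trace_of_sandwich b_tau _ bZ; rewrite subr_eq0.
Qed.

End BoundedTraces.

Lemma uniform_cvg_pointwise_limit (R : realType) (K : completeValuedFieldType R)
    (I : choiceType) (F : nat -> I -> K) (f f' : I -> K) :
  (forall i, (fun n => F n i) @ \oo --> f i) -> {uniform, F @ \oo --> f'} ->
  {uniform, F @ \oo --> f}.
Proof.
move=> Ff Ff'; suff -> : f = f' by [].
apply/funext => i; apply: (cvg_unique (@absv_hausdorff _ K) (Ff i)).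
move/uniform_absvP: Ff' => Ff'; apply/cvg_absvP => e /Ff'.
by apply: filterS => n; apply.
Qed.

Lemma trace_form_defined_over (K E : fieldType) (iota : {rmorphism K -> E})
    (G : groupType) d (rho : representation G d E) (sigma : representation G d K)
    (gs : 'I_(d * d) -> G) :
  is_basis (rho \o gs) -> (forall g, \tr (rho g) = iota (\tr (sigma g))) ->
  defined_over iota rho.
Proof.
move=> b_rho tr_rho.
have [g|P uP PP] := conjugate_of_trace b_rho (tau := extend_scalars iota sigma).
  by rewrite /= trace_map_mx tr_rho.
exists sigma, (invmx P); split=> [|g]; first by rewrite unitmx_inv.
by rewrite -PP conj_mxK.
Qed.

(* If the limit trace is unbounded, [rhos n] is conjugate to the limit as soon
   as the two traces are at bounded distance. *)
Lemma unbounded_uniformly_physically_convergent (R : realType)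
    (K : completeValuedFieldType R) (G : groupType) d (gs : 'I_(d * d) -> G)
    (rhos : nat -> representation G d K) (sigma : representation G d K) (T : G -> K) :
  (\forall n \near \oo, is_basis (rhos n \o gs)) -> is_basis (sigma \o gs) ->
  (forall g, \tr (sigma g) = T g) ->
  {uniform, (fun n g => \tr (rhos n g)) @ \oo --> T} -> ~ absv_bounded T ->
  uniformly_physically_convergent rhos.
Proof.
move=> near_basis b_sigma /funext <- /uniform_absvP tr_cvg unbounded.
have [|P [uP PP]] := @near_choice _ [set P : 'M[K]_d | P \in unitmx]
    (fun n P => forall g, conj_mx P (rhos n g) = sigma g) 1%:M (unitmx1 _ _).
  apply: filterS2 near_basis (tr_cvg 1 ltr01) => n b_rhos tr_n.
  have [|/unbounded|[P uP PP]] // := bounded_trace_or_conjugate b_rhos b_sigma.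
    by exists 1 => g; rewrite absvBC ltW.
  by exists P.
exists P; split=> // a b; exists (fun g => sigma g a b); apply/uniform_absvP => e e0.
by apply: filterS PP => n PP g; rewrite PP subrr absv0.
Qed.

Theorem theorem1p2 (R : realType) (K : completeValuedFieldType R)
    (G : groupType) (d : nat)
    (L : closedFieldType) (iota : {rmorphism K -> L})
    (rhos : nat -> representation G d K) (rho : representation G d L) :
  nontrivially_valued K ->
  algebraic_closure iota ->
  (1 <= d)%N ->
  (forall p : nat, p \in [pchar K] -> (d < p)%N) ->
  trace_convergent rhos ->
  limit_representation iota rhos rho ->
  irreducible rho ->
  [/\ \forall n \near \oo, absolutely_irreducible (rhos n),
      physically_convergent rhos,
      defined_over iota rho
    & uniformly_trace_convergent rhos -> uniformly_physically_convergent rhos].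
Proof.
move=> _ _ d_gt0 charK TnT [_ trT] irr; set T := limit_trace rhos in trT.
have [gs [i0 [gs0 b_rho]]] := irreducible_exists_basis irr.
have near_basis := near_is_basis trT b_rho TnT.
have [sigma [P [tr_sigma uP Pcvg]]] :=
  exists_physical_limit trT b_rho TnT gs0 (natr_neq0_pchar d_gt0 charK).
split.
- by apply: filterS near_basis => n; apply: basis_absolutely_irreducible.
- exists P; split=> // g a b; apply: (cvgP (sigma g a b)); apply: ucvg_unit.
  by apply: (Pcvg unit (fun=> g)) => k; apply: cvg_ucvg.
- apply: (trace_form_defined_over (sigma := sigma) b_rho) => g.
  by rewrite trT tr_sigma.
move=> [T' /(uniform_cvg_pointwise_limit TnT) TnT_uniform].
have [bT|unbounded] := pselect (absv_bounded T).
  exists P; split=> // a b; exists (fun g => sigma g a b).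
  have [k|//] := Pcvg G id _ a b.
  exact: (ucvg_comp (fun g => g * gs k)%g (conj bT TnT_uniform)).
have b_sigma := is_basis_trace_form trT b_rho tr_sigma.
exact: unbounded_uniformly_physically_convergent near_basis b_sigma tr_sigma _ _.
Qed.
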